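(* Consider the equations $$M=m\,\frac{\int_{\mathcal B((\tilde x,y),R)}\lambda e^{-\lambda r}\,dx\,dr}{\int_{D\setminus\mathcal B((\tilde x,y),R)}\lambda e^{-\lambda r}\,dx\,dr}\qquad(\ast)$$ and $$\frac{dmg}{2\lambda}+mg\,\frac{\int_{D\setminus\mathcal B((\tilde x,y),R)}r\lambda e^{-\lambda r}\,dx\,dr}{\int_{D\setminus\mathcal B((\tilde x,y),R)}\lambda e^{-\lambda r}\,dx\,dr}+Mgy=E\qquad(\ast\ast)$$ in the unknowns $y\ge R$ and $\lambda>0$. (i) There exists a unique $\lambda_*>0$ such that $(\ast\ast)$ holds with $y=R$. (ii) Suppose that $$M<m\,\frac{\int_{\mathcal B((\tilde x,R),R)}\lambda_* e^{-\lambda_* r}\,dx\,dr}{\int_{D\setminus\mathcal B((\tilde x,R),R)}\lambda_* e^{-\lambda_* r}\,dx\,dr}.$$ Then $(\ast)$–$(\ast\ast)$ have a unique solution $(y_A,\lambda_A)$, and $R<y_A<E/(Mg)$.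
   Context: Fix an integer $d\ge 2$, a bounded domain $D_b\subset\mathbb R^{d-1}$ with smooth boundary, and $R>0$. Assume that $D_b$ satisfies the inner ball condition with radius $R$: for every $x\in\partial D_b$ there is a unique open $(d-1)$-dimensional ball of radius $R$ contained in $D_b$ whose boundary is tangent to $\partial D_b$ at $x$, and $x$ is the only point of intersection of that ball's boundary with $\partial D_b$. Let $D=D_b\times[0,\infty)\subset\mathbb R^d$, and assume a closed ball of radius $R$ fits in the interior of $D$. Points of $\mathbb R^d$ are written $(x,y)$ with $x\in\mathbb R^{d-1}$ and $y\in\mathbb R$. $\mathcal B(z,r)$ denotes the open ball with center $z$ and radius $r$. Let $D_b'=\{x\in D_b:\mathcal B((x,y),R)\subset D\text{ for all }y>R\}$. In integrals of the form $\int_{D\setminus\mathcal B((\tilde x,y),R)}(\cdot)\,dx\,dr$ (and similarly over $\mathcal B((\tilde x,y),R)$): - $\tilde x$ is an arbitrary point of $D_b'$, and the value of the integral does not depend on this choice; - $dx$ is Lebesgue measure on $\mathbb R^{d-1}$ and $dr$ is Lebesgue measure in the vertical coordinate. Fix $m>0$, $M>0$, $g>0$ and $E>MgR$. *)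

(* Defs.v *)
From HB Require Import structures.
From mathcomp Require Import all_boot all_order all_algebra.
From mathcomp Require Import all_classical all_reals all_analysis.
Set Implicit Arguments. Unset Strict Implicit. Unset Printing Implicit Defensive.
Import Order.TTheory GRing.Theory Num.Theory.
Import numFieldNormedType.Exports.
Local Open Scope classical_set_scope.
Local Open Scope ring_scope.

Section Defs.
Variable R : realType.

(* RR n is the measurable space R^(n+1), realised as nested pairs
   (((x_0, x_1), x_2), ..., x_n) with the product sigma-algebras. *)
Fixpoint RR (n : nat) : {d : measure_display & measurableType d} :=
  match n with
  | 0 => existT _ _ (measurableTypeR R : measurableType _)
  | k.+1 => existT _ _ ((projT2 (RR k) * measurableTypeR R)%type : measurableType _)
  end.

Fixpoint leb (n : nat) : {measure set (projT2 (RR n)) -> \bar R} :=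
  match n return {measure set (projT2 (RR n)) -> \bar R} with
  | 0 => (@lebesgue_measure R : {measure set (measurableTypeR R) -> \bar R})
  | k.+1 => ((@leb k \x (@lebesgue_measure R))%E
              : {measure set (projT2 (RR k) * measurableTypeR R) -> \bar R})
  end.

Fixpoint toRV (n : nat) : projT2 (RR n) -> 'rV[R]_(n.+1) :=
  match n return projT2 (RR n) -> 'rV[R]_(n.+1) with
  | 0 => fun x => \row_(i < 1) x
  | k.+1 => fun p => \row_(i < k.+2)
      (if unlift ord_max i is Some j then @toRV k p.1 ord0 j else p.2)
  end.

(* a point of R^(n+2) = R^(n+1) x R in integration coordinates,
   read as a pair (x, r) with x in 'rV_(n+1) and r the vertical coordinate *)
Definition toPt (n : nat) (p : projT2 (RR n.+1)) : 'rV[R]_(n.+1) * R :=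
  (@toRV n p.1, p.2).

Definition intRd (n : nat) (S : set ('rV[R]_(n.+1) * R))
    (f : 'rV[R]_(n.+1) * R -> R) : R :=
  Rintegral (@leb n.+1) (@toPt n @^-1` S) (f \o @toPt n).

Definition enorm (k : nat) (x : 'rV[R]_k) : R :=
  Num.sqrt (\sum_(i < k) x ord0 i ^+ 2).

Definition edist (k : nat) (p q : 'rV[R]_k * R) : R :=
  Num.sqrt (\sum_(i < k) (p.1 ord0 i - q.1 ord0 i) ^+ 2 + (p.2 - q.2) ^+ 2).

Definition Ball (k : nat) (z : 'rV[R]_k * R) (r : R) : set ('rV[R]_k * R) :=
  [set p | edist p z < r].

Definition cBall (k : nat) (z : 'rV[R]_k * R) (r : R) : set ('rV[R]_k * R) :=
  [set p | edist p z <= r].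

Definition ballb (k : nat) (c : 'rV[R]_k) (r : R) : set 'rV[R]_k :=
  [set x | enorm (x - c) < r].
Definition sphereb (k : nat) (c : 'rV[R]_k) (r : R) : set 'rV[R]_k :=
  [set x | enorm (x - c) = r].

Definition bdry (T : topologicalType) (A : set T) : set T :=
  closure A `\` interior A.

Fixpoint iterD (k : nat) (vs : seq 'rV[R]_k) (f : 'rV[R]_k -> R)
    : 'rV[R]_k -> R :=
  match vs with
  | [::] => f
  | v :: vs' => fun x => 'D_v (iterD vs' f) x
  end.

Definition smooth_on (k : nat) (U : set 'rV[R]_k) (f : 'rV[R]_k -> R) :=
  forall (vs : seq 'rV[R]_k) (x : 'rV[R]_k), U x ->
    differentiable (iterD vs f) x.

Definition smooth_boundary (k : nat) (A : set 'rV[R]_k) :=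
  forall p, bdry A p ->
    exists (U : set 'rV[R]_k) (phi : 'rV[R]_k -> R),
      [/\ open U, U p, smooth_on U phi,
          (forall x, U x -> exists v, 'D_v phi x != 0) &
          (forall x, U x -> (A x <-> phi x < 0))].

Definition bounded_domain (k : nat) (A : set 'rV[R]_k) :=
  [/\ A !=set0, open A, connected A & bounded_set A].

Definition inner_ball_condition (k : nat) (A : set 'rV[R]_k) (Rr : R) :=
  forall x, bdry A x ->
    exists! c : 'rV[R]_k,
      [/\ ballb c Rr `<=` A, sphereb c Rr x &
          sphereb c Rr `&` bdry A = [set x]].

Definition cyl (k : nat) (Db : set 'rV[R]_k) : set ('rV[R]_k * R) :=
  [set p | Db p.1 /\ 0 <= p.2].

Definition Dbprime (k : nat) (Db : set 'rV[R]_k) (Rr : R) : set 'rV[R]_k :=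
  [set x | Db x /\ forall y, Rr < y -> Ball (x, y) Rr `<=` cyl Db].

End Defs.

(* Main.v *)
Require Import Defs.
From HB Require Import structures.
From mathcomp Require Import all_boot all_order all_algebra.
From mathcomp Require Import all_classical all_reals all_analysis.
From mathcomp Require Import measurable_realfun.
From mathcomp Require Import ring lra.
Import Order.TTheory GRing.Theory Num.Theory.
Import numFieldNormedType.Exports.
Local Open Scope classical_set_scope.
Local Open Scope ring_scope.

(* Let A be the area of the base, and let b(l) and b1(l) be the integrals of
   e^{-lt} and t e^{-lt} over a ball of radius R resting on the floor.  The
   integrals of the statement are IB = l e^{-l(y-R)} b, IO = A - IB and
   JO = A/l - l e^{-l(y-R)} (b1 + (y-R) b).

   For y = R the quotient JO/IO is the mean height of the gas outside the ball,
   which is nonincreasing in l, so the left-hand side of the second equation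
   decreases strictly from +oo to M g R: this gives (i).

   For (ii), Archimedes' principle: inserting the first equation into the second
   one cancels y and leaves  c - M l b1/b = l (E/g - M R)  with
   c = d m/2 + m + M.  Since l b1/b is nondecreasing (the slices of the ball have
   area proportional to (t(2R-t))^{(d-1)/2}), this equation has exactly one root,
   and y is then determined by the first equation.  That y > R follows from
   unimodality of l b(l), whose derivative is b - l b1. *)

Set Implicit Arguments. Unset Strict Implicit. Unset Printing Implicit Defensive.

(** * The equilibrium equations *)

(** Shared by both one-variable problems: the intermediate value theorem gives the root, strict
    decrease on [l > 0] its uniqueness. *)
Lemma decreasing_crossing {R : realType} (h : R -> R) (v a b : R) :
  0 < a -> a <= b ->
  (forall l, 0 < l -> {for l, continuous h}) ->
  (forall l1 l2, 0 < l1 -> l1 < l2 -> h l2 < h l1) ->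
  v <= h a -> h b <= v -> exists! l, 0 < l /\ h l = v.
Proof.
move=> a0 ab ch dh va bv.
have [l lab hl] : exists2 l, l \in `[a, b] & h l = v.
  apply: IVT => //; last by rewrite ge_min le_max va bv orbT.
  apply: continuous_in_subspaceT => x; rewrite inE/= in_itv/= => /andP[ax _].
  exact: ch (lt_le_trans a0 ax).
have l0 : 0 < l by move: lab; rewrite in_itv/= => /andP[al _]; exact: lt_le_trans al.
exists l; split=> // l' [l'0 hl'].
have [ll'|ll'|//] := ltgtP l l'.
- by have := dh _ _ l0 ll'; rewrite hl hl' ltxx.
- by have := dh _ _ l'0 ll'; rewrite hl hl' ltxx.
Qed.

Section Equilibrium.
(** The geometry enters only through the hypotheses below, with [k] standing for the dimension.
    [tau_mono] and [height_anti] state the monotonicity of [l * b1 l / b l] and of the mean height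
    outside the ball, cleared of denominators. *)
Variables (R : realType) (r m M g E k A : R) (b b1 : R -> R).
Hypotheses (r0 : 0 < r) (m0 : 0 < m) (M0 : 0 < M) (g0 : 0 < g) (rE : M * g * r < E).
Hypotheses (k0 : 0 < k) (A0 : 0 < A).
Hypothesis b_gt0 : forall l : R, 0 < l -> 0 < b l.
Hypothesis b1_ge0 : forall l : R, 0 < l -> 0 <= b1 l.
Hypothesis b1_le : forall l : R, 0 < l -> b1 l <= 2 * r * b l.
Hypothesis db : forall l : R, 0 < l -> is_derive l 1 b (- b1 l).
Hypothesis cb1 : forall l : R, 0 < l -> {for l, continuous b1}.
Hypothesis b_lt : forall l : R, 0 < l -> l * b l < A.
Hypothesis b_decay : exists2 L : R, 0 < L & forall l : R, L <= l -> l * b l <= A / 2.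
Hypothesis tau_mono : forall l1 l2 : R, 0 < l1 -> l1 <= l2 ->
  l1 * b1 l1 * b l2 <= l2 * b1 l2 * b l1.
Hypothesis height_anti : forall l1 l2 : R, 0 < l1 -> l1 <= l2 ->
  (A / l2 - l2 * b1 l2) * (A - l1 * b l1) <=
  (A / l1 - l1 * b1 l1) * (A - l2 * b l2).

Let IB (y l : R) := l * expR (- (l * (y - r))) * b l.
Let IO (y l : R) := A - IB y l.
Let JO (y l : R) := A / l - l * expR (- (l * (y - r))) * (b1 l + (y - r) * b l).
Hypothesis JO_ge0 : forall y l : R, r <= y -> 0 < l -> 0 <= JO y l.
Let eq1 (y l : R) := M = m * (IB y l / IO y l).
Let eq2 (y l : R) :=
  k * m * g / (2 * l) + m * g * (JO y l / IO y l) + M * g * y = E.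
Let h (l : R) := k * m * g / (2 * l) +
  m * g * ((A / l - l * b1 l) / (A - l * b l)) + M * g * r.

Let cb (l : R) : 0 < l -> {for l, continuous b}.
Proof.
by move=> l0; apply: differentiable_continuous; apply/derivable1_diffP; have [] := db l0.
Qed.

Let cinv (l : R) : 0 < l -> {for l, continuous (fun x : R => x^-1)}.
Proof. by move=> l0; apply: inv_continuous; rewrite gt_eqF. Qed.

Let IBr (l : R) : IB r l = l * b l.
Proof. by rewrite /IB subrr mulr0 oppr0 expR0 mulr1. Qed.

Let eq2r (l : R) : eq2 r l <-> h l = E.
Proof.
by rewrite /eq2 /h /JO /IO IBr subrr mulr0 oppr0 expR0 mulr1 mul0r addr0.
Qed.

Let ch (l : R) : 0 < l -> {for l, continuous h}.
Proof.
move=> l0; have cl := cinv l0.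
have cid : x @[x --> l] --> l by exact: cvg_id.
rewrite /h; apply: cvgD; last exact: cvg_cst.
apply: cvgD.
  apply: cvgM; first exact: cvg_cst.
  apply: (@cvgV _ _ _ _ (fun x => 2 * x)); first by rewrite mulf_neq0 ?gt_eqF.
  by apply: cvgM; first exact: cvg_cst.
apply: cvgM; first exact: cvg_cst.
apply: cvgM.
  apply: cvgB; first by apply: cvgM; [exact: cvg_cst|].
  by apply: cvgM => //; exact: cb1.
apply: (@cvgV _ _ _ _ (fun x => A - x * b x)).
  by rewrite gt_eqF// subr_gt0 b_lt.
apply: cvgB; first exact: cvg_cst.
by apply: cvgM => //; exact: cb.
Qed.

(** Strictness comes from the [1 / l] term alone; the mean height is only weakly decreasing, by
    [height_anti]. *)
Let h_decr (l1 l2 : R) : 0 < l1 -> l1 < l2 -> h l2 < h l1.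
Proof.
move=> l10 l12; have l20 := lt_trans l10 l12.
rewrite /h ltrD2r; apply: ltr_leD.
  rewrite ltr_pM2l ?mulr_gt0// ltf_pV2 ?posrE ?mulr_gt0//.
  by rewrite ltr_pM2l.
rewrite ler_pM2l ?mulr_gt0//.
rewrite ler_pdivrMr ?subr_gt0 ?b_lt// mulrAC ler_pdivlMr ?subr_gt0 ?b_lt//.
exact: height_anti (ltW l12).
Qed.

Lemma equilibrium_bottom : exists! l, 0 < l /\ eq2 r l.
Proof.
have E0 : 0 < E by apply: lt_trans rE; rewrite !mulr_gt0.
suff [l [l0 lP]] : exists! l, 0 < l /\ h l = E.
  exists l; split => [|l']; first by rewrite eq2r.
  by rewrite eq2r; exact: lP.
have [L L0 HL] := b_decay.
(* Beyond [L] the denominator of the mean height is at least [A / 2], so this mean is at most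
   [2 / u] and [h u <= c / u + M * g * r]; this dictates [u]. Up to [k * m * g / (2 * E)] the first
   term of [h] alone is at least [E]; this dictates [a]. *)
pose c := k * m * g / 2 + 2 * m * g.
have c0 : 0 < c by rewrite addr_gt0// ?divr_gt0 ?mulr_gt0.
pose u := Num.max L (c / (E - M * g * r)).
have u0 : 0 < u by rewrite lt_max L0.
pose a := Num.min u (k * m * g / (2 * E)).
have a0 : 0 < a by rewrite lt_min u0 divr_gt0 ?mulr_gt0.
have au : a <= u by rewrite ge_min lexx.
apply: (decreasing_crossing a0 au ch h_decr).
  have H1 : E <= k * m * g / (2 * a).
    have : a <= k * m * g / (2 * E) by rewrite ge_min lexx orbT.
    rewrite !ler_pdivlMr ?mulr_gt0// => H.
    by rewrite mulrCA [E * a]mulrC mulrCA.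
  have T0 : 0 <= (A / a - a * b1 a) / (A - a * b a).
    rewrite divr_ge0 ?subr_ge0 ?(ltW (b_lt a0))//.
    have := JO_ge0 (lexx r) a0.
    by rewrite /JO subrr mulr0 oppr0 expR0 mulr1 mul0r addr0 subr_ge0.
  rewrite /h; have : 0 <= m * g * ((A / a - a * b1 a) / (A - a * b a)).
    by rewrite mulr_ge0// mulr_ge0 ?ltW.
  have : 0 <= M * g * r by rewrite !mulr_ge0 ?ltW.
  by move=> ? ?; lra.
have Lu : L <= u by rewrite le_max lexx.
have HA := HL _ Lu.
have T1 : (A / u - u * b1 u) / (A - u * b u) <= 2 / u.
  rewrite ler_pdivrMr ?subr_gt0 ?b_lt//.
  have : 2 / u * (A / 2) <= 2 / u * (A - u * b u).
    by rewrite ler_pM2l ?divr_gt0//; lra.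
  apply: le_trans.
  rewrite (_ : 2 / u * (A / 2) = A / u); last by field; rewrite gt_eqF.
  by rewrite gerBl mulr_ge0 ?b1_ge0 ?ltW.
have : c / (E - M * g * r) <= u by rewrite le_max lexx orbT.
rewrite ler_pdivrMr ?subr_gt0// => H.
have cu : c / u <= E - M * g * r by rewrite ler_pdivrMr// mulrC.
have : m * g * ((A / u - u * b1 u) / (A - u * b u)) <= m * g * (2 / u).
  by rewrite ler_pM2l ?mulr_gt0.
rewrite /h; have : c / u = k * m * g / (2 * u) + m * g * (2 / u).
  by rewrite /c; field; rewrite gt_eqF.
by move=> ? ?; lra.
Qed.

Let c := k * m / 2 + m + M.

(** As [IO = A - IB], the equation is linear in [IB] and prescribes its value, independently of [y]
    and [l]. *)
Let eq1E (y l : R) : 0 < IO y l -> (eq1 y l <-> IB y l = A * M / (m + M)).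
Proof.
move=> IO0; have mM : m + M != 0 by rewrite gt_eqF// addr_gt0.
split => [e1|IBE].
  have /(congr1 ( *%R^~ (IO y l))) := e1.
  rewrite -mulrA divfK ?gt_eqF// /IO mulrBr => H.
  by apply: (mulIf mM); rewrite divfK// mulrDr; lra.
have AN : A != 0 by rewrite gt_eqF.
have mN : m != 0 by rewrite gt_eqF.
rewrite /eq1; have -> : IO y l = A * m / (m + M) by rewrite /IO IBE; field.
by rewrite IBE; field; rewrite mM AN mN.
Qed.

(* Substituting [eq1] into [eq2] cancels [y] (Archimedes' principle) and leaves an
   equation in [l] alone. *)
Let reduced (y l : R) : 0 < l -> 0 < IO y l -> eq1 y l ->
  (eq2 y l <-> c - M * (l * b1 l / b l) = l * (E / g - M * r)).
Proof.
move=> l0 IO0 e1.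
have bl := b_gt0 l0.
have /(eq1E IO0) IBE := e1.
have IOE : IO y l = A * m / (m + M).
  by rewrite /IO IBE; field; rewrite gt_eqF// addr_gt0.
have JE : JO y l = A / l - A * M / (m + M) * (b1 l / b l + (y - r)).
  by rewrite /JO -IBE /IB; field; rewrite !gt_eqF.
rewrite /eq2 IOE JE.
have gN : g != 0 by rewrite gt_eqF.
have lN : l != 0 by rewrite gt_eqF.
have mN : m != 0 by rewrite gt_eqF.
have AN : A != 0 by rewrite gt_eqF.
have bN : b l != 0 by rewrite gt_eqF.
have mMN : m + M != 0 by rewrite gt_eqF// addr_gt0.
have -> : k * m * g / (2 * l) + m * g * ((A / l - A * M / (m + M) *
   (b1 l / b l + (y - r))) / (A * m / (m + M))) + M * g * y =
   g / l * (c - M * (l * b1 l / b l)) + M * g * r.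
  by rewrite /c; field; rewrite mMN bN lN AN mN.
split => [<-|->]; field; by rewrite ?gN ?lN ?bN.
Qed.

(** The exponential factor is at most 1 when [r <= y], so [IB y l <= l * b l < A]. Hence no quotient
    by [IO] is a division by zero. *)
Let IO_gt0 (y l : R) : r <= y -> 0 < l -> 0 < IO y l.
Proof.
move=> ry l0; rewrite subr_gt0; apply: le_lt_trans (b_lt l0).
rewrite /IB mulrAC ler_piMr ?(ltW (mulr_gt0 l0 (b_gt0 l0)))//.
by rewrite -expR0 ler_expR oppr_le0 mulr_ge0 ?subr_ge0// ltW.
Qed.

Let dphi (l : R) : 0 < l -> is_derive l 1 (fun x => x * b x) (b l - l * b1 l).
Proof.
move=> l0; have := db l0 => dbl.
have := @is_deriveM _ _ id b l 1 1 _ (is_derive_id _ _) dbl.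
by rewrite /GRing.scale/= mulr1 mulrN addrC.
Qed.

(** The derivative is nonnegative where [x * b1 x / b x <= 1]; by [tau_mono] this condition at [l2]
    passes to all smaller [x]. *)
Let phi_nondecr (l1 l2 : R) : 0 < l1 -> l1 <= l2 -> l2 * b1 l2 <= b l2 ->
  l1 * b l1 <= l2 * b l2.
Proof.
move=> l10 l12 H2; have l20 := lt_le_trans l10 l12.
have dl (x : R) : x \in `]l1, l2[ -> 0 < x.
  by rewrite in_itv/= => /andP[l1x _]; exact: lt_trans l1x.
have Hx (x : R) : x \in `]l1, l2[ -> 0 <= b x - x * b1 x.
  move=> xI; have x0 := dl _ xI; move: xI; rewrite in_itv/= => /andP[_ xl2].
  rewrite subr_ge0 -(ler_pM2r (b_gt0 l20)).
  apply: (le_trans (tau_mono x0 (ltW xl2))).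
  by rewrite mulrC ler_pM2l ?b_gt0.
apply: (@ger0_derive1_le_cc _ (fun x => x * b x) l1 l2) => //.
- by move=> x /dl x0; have [] := dphi x0.
- by move=> x xI; rewrite derive1E (@derive_val _ _ _ _ _ _ _ (dphi (dl _ xI))) Hx.
- apply: continuous_in_subspaceT => x; rewrite inE/= in_itv/= => /andP[ax _].
  by apply: cvgM => //; apply: cb; exact: lt_le_trans ax.
- by rewrite in_itv/= lexx l12.
- by rewrite in_itv/= lexx l12.
Qed.

(** Mirror image: the condition [x * b1 x / b x >= 1] passes from [l1] to all larger [x]. *)
Let phi_nonincr (l1 l2 : R) : 0 < l1 -> l1 <= l2 -> b l1 <= l1 * b1 l1 ->
  l2 * b l2 <= l1 * b l1.
Proof.
move=> l10 l12 H1; have l20 := lt_le_trans l10 l12.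
have dl (x : R) : x \in `]l1, l2[ -> 0 < x.
  by rewrite in_itv/= => /andP[l1x _]; exact: lt_trans l1x.
have Hx (x : R) : x \in `]l1, l2[ -> b x - x * b1 x <= 0.
  move=> xI; have x0 := dl _ xI; move: xI; rewrite in_itv/= => /andP[l1x _].
  rewrite subr_le0 -(ler_pM2r (b_gt0 l10)).
  apply: le_trans (tau_mono l10 (ltW l1x)).
  by rewrite mulrC ler_pM2r ?b_gt0.
apply: (@ler0_derive1_le_cc _ (fun x => x * b x) l1 l2) => //.
- by move=> x /dl x0; have [] := dphi x0.
- by move=> x xI; rewrite derive1E (@derive_val _ _ _ _ _ _ _ (dphi (dl _ xI))) Hx.
- apply: continuous_in_subspaceT => x; rewrite inE/= in_itv/= => /andP[ax _].
  by apply: cvgM => //; apply: cb; exact: lt_le_trans ax.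
- by rewrite in_itv/= lexx l12.
- by rewrite in_itv/= lexx l12.
Qed.

Let c0 : 0 < c. Proof. by rewrite !addr_gt0// divr_gt0 ?mulr_gt0. Qed.

Let rE' : 0 < E / g - M * r.
Proof. by rewrite subr_gt0 ltr_pdivlMr// mulrAC. Qed.

Let reduced_solution :
  exists! l : R, 0 < l /\ c - M * (l * b1 l / b l) - l * (E / g - M * r) = 0.
Proof.
pose f (l : R) := c - M * (l * b1 l / b l) - l * (E / g - M * r).
have f_decr (l1 l2 : R) : 0 < l1 -> l1 < l2 -> f l2 < f l1.
  move=> l10 l12; have l20 := lt_trans l10 l12.
  rewrite /f ler_ltD//; last by rewrite ltrN2 ltr_pM2r.
  rewrite lerD2l lerN2 ler_pM2l// ler_pdivrMr ?b_gt0// mulrAC ler_pdivlMr ?b_gt0//.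
  exact: tau_mono (ltW l12).
have f_cont (l : R) : 0 < l -> {for l, continuous f}.
  move=> l0; have cid : x @[x --> l] --> l by exact: cvg_id.
  apply: cvgB; last by apply: cvgM => //; exact: cvg_cst.
  apply: cvgB; first exact: cvg_cst.
  apply: cvgM; first exact: cvg_cst.
  apply: cvgM; last by apply: cvgV; [rewrite gt_eqF ?b_gt0|exact: cb].
  by apply: cvgM => //; exact: cb1.
(* At [a] the bound [b1 <= 2 * r * b] makes [f] nonnegative; at [d] the constant and linear terms
   cancel, leaving a nonpositive multiple of [b1 d]. *)
pose a := c / (M * (2 * r) + (E / g - M * r)).
pose d := c / (E / g - M * r).
have D0 : 0 < M * (2 * r) + (E / g - M * r) by rewrite addr_gt0// !mulr_gt0.
have a0 : 0 < a by rewrite divr_gt0.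
have d0 : 0 < d by rewrite divr_gt0.
have ad : a <= d.
  by rewrite ler_pM2l// lef_pV2 ?posrE// lerDr !mulr_ge0// ltW.
apply: (decreasing_crossing a0 ad f_cont f_decr).
  rewrite /f (_ : c = a * (M * (2 * r) + (E / g - M * r))); last first.
    by rewrite divfK ?gt_eqF.
  have : M * (a * b1 a / b a) <= M * (a * (2 * r)).
    by rewrite ler_pM2l// -mulrA ler_pM2l// ler_pdivrMr ?b_gt0// b1_le.
  by move=> ?; lra.
rewrite /f divfK ?gt_eqF// addrAC subrr sub0r oppr_le0.
by rewrite mulr_ge0 ?(ltW M0)// divr_ge0 ?(ltW (b_gt0 d0))// mulr_ge0 ?b1_ge0 ?(ltW d0).
Qed.

Let IBexp (y l : R) : IB y l = l * b l * expR (- (l * (y - r))).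
Proof. by rewrite /IB mulrAC. Qed.

(* At the root [lA] of the reduced equation, [phi lA > A M / (m + M)]: otherwise
   the sign of [b lA - lA * b1 lA] puts [lA] and [ls] on the same monotone branch
   of [phi l = l * b l], in the order that contradicts [HM]. *)
Lemma equilibrium (ls : R) : 0 < ls -> eq2 r ls ->
  M < m * (IB r ls / IO r ls) ->
  exists yA lA,
    [/\ (r <= yA /\ 0 < lA /\ eq1 yA lA /\ eq2 yA lA),
        (forall y l, r <= y -> 0 < l -> eq1 y l -> eq2 y l -> y = yA /\ l = lA),
        r < yA & yA < E / (M * g)].
Proof.
move=> ls0 /eq2r hls HM.
(* The value of [IB] forced by [eq1]. *)
pose q := A * M / (m + M).
have mM0 : 0 < m + M by rewrite addr_gt0.
have q0 : 0 < q by rewrite divr_gt0 ?mulr_gt0.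
have qA : q < A by rewrite ltr_pdivrMr// ltr_pM2l// ltrDr.
have phils : q < ls * b ls.
  move: HM; rewrite /IO IBr mulrA ltr_pdivlMr ?subr_gt0 ?b_lt// => H.
  by rewrite ltr_pdivrMr// mulrDr; lra.
have [l [[l0 fl] lU]] := reduced_solution.
have bl := b_gt0 l0.
have philA : q < l * b l.
  rewrite ltNge; apply/negP => lq.
  pose t := b1 l / b l.
  have AqN : A - q != 0 by rewrite gt_eqF// subr_gt0.
  have gN : g != 0 by rewrite gt_eqF.
  have lN : l != 0 by rewrite gt_eqF.
  have mN : m != 0 by rewrite gt_eqF.
  have AN : A != 0 by rewrite gt_eqF.
  have bN : b l != 0 by rewrite gt_eqF.
  have mMN : m + M != 0 by rewrite gt_eqF.
  (* With [t] fixed, [E] and [h l] are values of one expression, at [x = q] and at [x = l * b l],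
     through the fraction [(A / l - x * t) / (A - x)]. By [cross] this fraction is monotone in [x],
     in the direction given by the sign of [1 - l * t]. *)
  have HE : k * m * g / (2 * l) + m * g * ((A / l - q * t) / (A - q)) + M * g * r = E.
    have AqE : A - q = A * m / (m + M) by rewrite /q; field.
    have fl' : E / g = c / l - M * t + M * r.
      apply: (mulfI lN); rewrite -[LHS]addr0 -[in LHS]fl /t; field.
      by rewrite bN lN gN.
    rewrite -[RHS](divfK gN) fl' AqE /q /c; field.
    by rewrite mMN lN AN mN.
  have hl : h l = k * m * g / (2 * l) +
      m * g * ((A / l - l * b l * t) / (A - l * b l)) + M * g * r.
    by rewrite /h /t; congr (_ + _ * (_ / _) + _); field; rewrite bN lN.
  have cross (x y : R) : (A / l - y * t) * (A - x) - (A / l - x * t) * (A - y) =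
      A * (y - x) * (1 - l * t) / l by field.
  have frac_le (x y : R) : x < A -> y < A -> 0 <= A * (y - x) * (1 - l * t) / l ->
      (A / l - x * t) / (A - x) <= (A / l - y * t) / (A - y).
    move=> xA yA; rewrite -cross subr_ge0 => H.
    by rewrite ler_pdivrMr ?subr_gt0// [leRHS]mulrAC ler_pdivlMr ?subr_gt0.
  have tE : 1 - l * t = (b l - l * b1 l) / b l by rewrite /t; field.
  have plA := b_lt l0.
  have [tl|tl] := leP (l * b1 l) (b l).
    have : h l <= E.
      rewrite hl -HE lerD2r lerD2l ler_pM2l ?mulr_gt0//.
      rewrite frac_le// tE divr_ge0 ?(ltW l0)// mulr_ge0//.
        by rewrite mulr_ge0 ?(ltW A0)// subr_ge0.
      by rewrite divr_ge0 ?(ltW bl)// subr_ge0.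
    rewrite -hls => hle.
    have lsl : ls <= l.
      by rewrite leNgt; apply/negP => lls; have := h_decr l0 lls; rewrite ltNge hle.
    have := phi_nondecr ls0 lsl tl.
    by rewrite leNgt (le_lt_trans lq phils).
  have : E <= h l.
    rewrite hl -HE lerD2r lerD2l ler_pM2l ?mulr_gt0//.
    rewrite frac_le// tE divr_ge0 ?(ltW l0)//.
    rewrite -mulrNN mulr_ge0//.
      by rewrite -mulrN opprB mulr_ge0 ?(ltW A0)// subr_ge0.
    by rewrite -mulNr opprB divr_ge0 ?(ltW bl)// subr_ge0 ltW.
  rewrite -hls => hle.
  have lls : l <= ls.
    by rewrite leNgt; apply/negP => lls; have := h_decr ls0 lls; rewrite ltNge hle.
  have := phi_nonincr l0 lls (ltW tl).
  by rewrite leNgt (le_lt_trans lq phils).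
(* Solves [l * b l * expR (- (l * (y - r))) = q]; the logarithm is positive by [philA], whence
   [r < y]. *)
pose y := r + ln (l * b l / q) / l.
have ry : r < y by rewrite ltrDl divr_gt0// ln_gt0// ltr_pdivlMr// mul1r.
have IO0 := IO_gt0 (ltW ry) l0.
have e1 : eq1 y l.
  apply/eq1E => //; rewrite IBexp /y addrAC subrr add0r mulrCA divff ?gt_eqF// mulr1.
  rewrite expRN lnK ?posrE ?divr_gt0 ?mulr_gt0// invf_div mulrC divfK// gt_eqF//.
  by rewrite mulr_gt0.
have e2 : eq2 y l by apply/reduced => //; lra.
exists y, l; split => //; first by split; first exact: ltW.
  move=> y' l' ry' l'0 e1' e2'.
  have IO0' := IO_gt0 ry' l'0.
  have ll' : l = l'.
    apply: lU; split => //.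
    by have /(reduced l'0 IO0' e1') := e2' => ->; rewrite subrr.
  split => //; subst l'.
  move: e1 e1'; rewrite !eq1E// => e1 e1'.
  have /mulfI : l * b l != 0 by rewrite mulf_neq0 ?gt_eqF.
  move=> /(_ (expR (- (l * (y' - r)))) (expR (- (l * (y - r))))).
  rewrite -!IBexp e1 e1' => /(_ erefl) /expR_inj /oppr_inj.
  by move=> /(mulfI (lt0r_neq0 l0)) /(congr1 (+%R^~ r)); rewrite !subrK.
(* In [eq2] the first term is positive and the second nonnegative, so [M * g * y < E]. *)
rewrite ltr_pdivlMr ?mulr_gt0// mulrC -e2 ltrDr.
rewrite ltr_wpDr ?divr_gt0 ?mulr_gt0//.
have JO0 := JO_ge0 (ltW ry) l0.
by rewrite mulr_ge0 ?divr_ge0 ?(ltW IO0)// mulr_ge0 ?(ltW m0) ?(ltW g0).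
Qed.

End Equilibrium.

(** * One-dimensional integrals *)

Section RealIntegrals.
Context {R : realType}.
Notation mu := (@lebesgue_measure R).

(** The pushforward of Lebesgue measure under [phi], multiplied by [s], agrees with Lebesgue measure
    on half-open intervals, hence on all measurable sets. *)
Lemma ge0_integral_affine (a s : R) (f : R -> \bar R) : 0 < s ->
  measurable_fun [set: R] f -> (forall x, 0 <= f x)%E ->
  (\int[mu]_x f x = s%:E * \int[mu]_x f (a + s * x)%R)%E.
Proof.
move=> s0 mf f0.
pose phi (x : measurableTypeR R) : measurableTypeR R := a + s * x.
have mphi : measurable_fun setT phi.
  by apply: measurable_funD => //; exact: measurable_funM.
pose snn : {nonneg R} := NngNum (ltW s0).
pose nu : {measure set (measurableTypeR R) -> \bar R} := 
  mscale snn (measure_function_pushforward__canonical__measure_function_Measure mu mphi).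
have E A : measurable A -> mu A = nu A.
  apply: lebesgue_measure_unique => X [[x y] _ <-].
  rewrite /nu/= /mscale/= /pushforward.
  have -> : phi @^-1` `]x, y] = `](x - a) / s, (y - a) / s]%classic.
    apply/seteqP; split => z /=; rewrite !in_itv/= /phi.
      by rewrite ltr_pdivrMr// ler_pdivlMr// ltrBlDl lerBrDl (mulrC z).
    by rewrite ltr_pdivrMr// ler_pdivlMr// ltrBlDl lerBrDl (mulrC z).
  rewrite !lebesgue_measure_itv/= !lte_fin ltr_pM2r ?invr_gt0// ltrD2r.
  case: ifPn => _; last by rewrite mule0.
  by rewrite -!EFinD -EFinM; congr EFin; field; rewrite gt_eqF.
rewrite (eq_measure_integral nu); last by move=> A mA _; exact: E.
rewrite /nu ge0_integral_mscale// ge0_integral_pushforward//.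
Qed.

(** On the middle half of the interval the continuous [w] attains a positive minimum, and that half
    has length [c / 2]. *)
Lemma integral_gt0 (w : R -> R) (c : R) : 0 < c -> continuous w ->
  (forall t, 0 <= t <= c -> 0 <= w t) -> (forall t, 0 < t < c -> 0 < w t) ->
  0 < \int[mu]_(t in `[0, c]) w t.
Proof.
move=> c0 cw w0 wp.
have c4 : c / 4 <= c * 3 / 4 by lra.
have [|x xI wx] := @EVT_min _ w (c / 4) (c * 3 / 4) c4; first exact: continuous_subspaceT.
have wx0 : 0 < w x by apply: wp; move: xI; rewrite in_itv/= => /andP[? ?]; lra.
have mw : measurable_fun [set: R] w by exact: continuous_measurable_fun.
have iw : mu.-integrable `[0, c] (EFin \o w).
  by apply: continuous_compact_integrable; [exact: segment_compact|exact: continuous_subspaceT].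
pose J : set R := `[c / 4, c * 3 / 4]%classic.
have mJ : measurable J by exact: measurable_itv.
have S : J `<=` `[0, c].
  by move=> t /=; rewrite /J/= !in_itv/= => /andP[? ?]; apply/andP; split; lra.
rewrite -lte_fin /Rintegral fineK; last exact: integrable_fin_num.
apply: (@lt_le_trans _ _ (\int[mu]_(t in J) (w x)%:E)%E).
  rewrite /J integral_cst//= lebesgue_measure_itv/= lte_fin.
  have -> : c / 4 < c * 3 / 4 by lra.
  by rewrite -EFinB -EFinM lte_fin mulr_gt0//; lra.
apply: (@le_trans _ _ (\int[mu]_(t in J) (w t)%:E)%E).
  apply: ge0_le_integral => //.
  - by move=> t _; rewrite lee_fin ltW.
  - by apply/measurable_EFinP; exact: measurable_funS mw.
apply: ge0_subset_integral => //.
- by apply/measurable_EFinP; exact: measurable_funS mw.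
Qed.

Definition laplace (c : R) (w : R -> R) (l : R) : R :=
  \int[mu]_(t in `[0, c]) (w t * expR (- l * t)).

Lemma continuous_laplace_kernel (w : R -> R) (l : R) : continuous w ->
  continuous (fun t => w t * expR (- l * t)).
Proof.
move=> cw t; apply: cvgM; first exact: cw.
apply: (@continuous_comp _ _ _ (fun t => - l * t) expR); last exact: continuous_expR.
by apply: cvgM; [exact: cvg_cst|exact: cvg_id].
Qed.

Lemma integrable_laplace (c : R) (w : R -> R) (l : R) : continuous w ->
  mu.-integrable `[0, c] (EFin \o (fun t => w t * expR (- l * t))).
Proof.
move=> cw; apply: continuous_compact_integrable; first exact: segment_compact.
by apply: continuous_subspaceT; exact: continuous_laplace_kernel.
Qed.

Lemma is_derive_laplace (c : R) (w : R -> R) (l : R) : continuous w ->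
  is_derive l 1 (laplace c w) (- laplace c (fun t => t * w t) l).
Proof.
move=> cw.
pose f (x t : R) := w t * expR (- x * t).
have df (x t : R) : is_derive x 1 (f ^~ t) (- (t * w t) * expR (- x * t)).
  rewrite /f.
  have d1 : is_derive x 1 (fun x : R => - x * t) (- t).
    apply: is_derive_eq; rewrite /GRing.scale/= mulr0 add0r mulrN1.
    by [].
  have := @is_derive1_comp _ expR (fun x : R => - x * t) x _ _ (is_derive_expR _) d1.
  move=> d2; apply: is_derive_eq.
  by rewrite /GRing.scale/=; ring.
have cw1 : continuous (fun t : R => t * w t).
  by move=> t; apply: cvgM; [exact: cvg_id|exact: cw].
have Il : (`]l - 1, l + 1[%classic : set R) l by rewrite /= in_itv/=; apply/andP; split; lra.
(* Dominating function for parameters [x] within distance 1 of [l], where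
   [- x * t <= (|l| + 1) * |c|]. *)
pose G (t : R) := `|t * w t| * expR ((`|l| + 1) * `|c|).
have intG : mu.-integrable `[0, c] (EFin \o G).
  apply: continuous_compact_integrable; first exact: segment_compact.
  apply: continuous_subspaceT => t; apply: cvgM; last exact: cvg_cst.
  by apply: cvg_norm; exact: cw1.
have Gub (x t : R) : `]l - 1, l + 1[%classic x -> `[0, c]%classic t ->
    `|partial1of2 f x t| <= G t.
  rewrite /= !in_itv/= => /andP[x1 x2] /andP[t0 tc].
  rewrite partial1of2E (@derive_val _ _ _ _ _ _ _ (df x t)).
  rewrite normrM normrN ler_wpM2l// ger0_norm ?expR_ge0// ler_expR.
  have c0 : 0 <= c := le_trans t0 tc.
  apply: (@le_trans _ _ (`|x| * `|c|)).
    by rewrite (le_trans (ler_norm _))// normrM normrN ler_wpM2l// !ger0_norm.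
  rewrite ler_wpM2r// ler_norml; have := ler_norm l; have := ler_norm (- l).
  by rewrite normrN => ? ?; apply/andP; split; lra.
have mI : measurable (`[0, c]%classic : set (measurableTypeR R)) by [].
have intf (x : R) : `]l - 1, l + 1[%classic x -> mu.-integrable `[0, c] (EFin \o f x).
  by move=> _; exact: integrable_laplace.
have derf (x t : R) : `]l - 1, l + 1[%classic x -> `[0, c]%classic t -> derivable (f ^~ t) x 1.
  by move=> _ _; have [] := df x t.
have G0 t : 0 <= G t by rewrite mulr_ge0 ?expR_ge0.
have D1 := derivable_under_integral mI Il intf derf G0 intG Gub.
apply: DeriveDef => //.
rewrite -derive1E (differentiation_under_integral mI Il intf derf G0 intG Gub).
rewrite /laplace -mulN1r -RintegralZl//; last exact: integrable_laplace.
apply: eq_Rintegral => t _.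
rewrite partial1of2E (@derive_val _ _ _ _ _ _ _ (df l t)).
by rewrite mulN1r mulNr.
Qed.

(* Up to a factor, the measure of the horizontal slice at height [t] of a ball of
   radius [r] resting on the floor, in dimension [k.+2]. *)
Definition cap (k : nat) (r t : R) : R := Num.sqrt (t * (2 * r - t)) ^+ k.+1.

Lemma continuous_cap k r : continuous (cap k r).
Proof.
move=> t; rewrite /cap.
apply: (@continuous_comp _ _ _ (fun t : R => Num.sqrt (t * (2 * r - t))) (fun x : R => x ^+ k.+1));
  last exact: exprn_continuous.
apply: (@continuous_comp _ _ _ (fun t : R => t * (2 * r - t)) Num.sqrt); last exact: sqrt_continuous.
apply: cvgM; first exact: cvg_id.
by apply: cvgB; [exact: cvg_cst|exact: cvg_id].
Qed.

Lemma cap_ge0 k r t : 0 <= cap k r t.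
Proof. by rewrite exprn_ge0 ?sqrtr_ge0. Qed.

Lemma cap_gt0 k r t : 0 < t < 2 * r -> 0 < cap k r t.
Proof. by move=> /andP[t0 tr]; rewrite exprn_gt0// sqrtr_gt0 mulr_gt0// subr_gt0. Qed.

(** [Num.sqrt] is 0 on nonpositive numbers and the exponent [k.+1] is not 0, so [cap] extends itself
    by zero. Integrals over [[0, 2 * r]] may thus be taken over the whole line. *)
Lemma cap_eq0 k r t : 0 <= r -> ~~ (0 < t < 2 * r) -> cap k r t = 0.
Proof.
move=> r0 H; rewrite /cap ler0_sqrtr ?expr0n//.
move: H; rewrite negb_and -!leNgt => /orP[t0|tr].
  by rewrite mulr_le0_ge0// subr_ge0 (le_trans t0)// mulr_ge0.
by rewrite mulr_ge0_le0 ?subr_le0// (le_trans _ tr)// mulr_ge0.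
Qed.

Lemma integral_supp (c : R) (w : R -> R) :
  (forall t, ~~ (0 < t < c) -> w t = 0) ->
  (\int[mu]_t (w t)%:E = \int[mu]_(t in `[0%R, c]) (w t)%:E)%E.
Proof.
move=> w0; rewrite [RHS]integral_mkcond; apply: eq_integral => t _.
rewrite patchE; case: ifPn => // /negP tc; rewrite w0//; apply/negP => /andP[t0 tc'].
by apply: tc; rewrite inE /= in_itv/= !ltW.
Qed.

Lemma integral_cap_fin (k : nat) (r V : R) : 0 < r -> 
  (\int[mu]_t (V * cap k r t)%:E =
   (\int[mu]_(t in `[0, 2 * r]) (V * cap k r t))%:E)%E.
Proof.
move=> r0; rewrite (@integral_supp (2 * r)); last first.
  by move=> t H; rewrite cap_eq0 ?mulr0// ltW.
rewrite /Rintegral fineK//; apply: integrable_fin_num => //.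
apply: continuous_compact_integrable; first exact: segment_compact.
apply: continuous_subspaceT => t.
by apply: cvgM; [exact: cvg_cst|exact: continuous_cap].
Qed.
End RealIntegrals.

(** * Laplace transforms of the slice profile of a ball *)

Section Profile.
Context {R : realType}.
Notation mu := (@lebesgue_measure R).

Lemma laplaceZ (c k : R) (w : R -> R) (l : R) : continuous w ->
  laplace c (fun t => k * w t) l = k * laplace c w l.
Proof.
move=> cw; rewrite /laplace -RintegralZl//; last exact: integrable_laplace.
by apply: eq_Rintegral => t _; rewrite mulrA.
Qed.

Lemma laplaceD (c : R) (w1 w2 : R -> R) (l : R) : continuous w1 -> continuous w2 ->
  laplace c (fun t => w1 t + w2 t) l = laplace c w1 l + laplace c w2 l.
Proof.
move=> cw1 cw2; rewrite /laplace -RintegralD//; try exact: integrable_laplace.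
by apply: eq_Rintegral => t _; rewrite mulrDl.
Qed.

Lemma laplaceB (c : R) (w1 w2 : R -> R) (l : R) : continuous w1 -> continuous w2 ->
  laplace c (fun t => w1 t - w2 t) l = laplace c w1 l - laplace c w2 l.
Proof.
move=> cw1 cw2; rewrite /laplace -RintegralB//; try exact: integrable_laplace.
by apply: eq_Rintegral => t _; rewrite mulrBl.
Qed.

Lemma laplace_ge0 (c : R) (w : R -> R) (l : R) :
  (forall t, 0 <= t <= c -> 0 <= w t) -> 0 <= laplace c w l.
Proof.
move=> w0; apply: Rintegral_ge0 => t; rewrite /= in_itv/= => /w0 wt.
by rewrite mulr_ge0 ?expR_ge0.
Qed.

Lemma laplace_gt0 (c : R) (w : R -> R) (l : R) : 0 < c -> continuous w ->
  (forall t, 0 <= t <= c -> 0 <= w t) -> (forall t, 0 < t < c -> 0 < w t) ->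
  0 < laplace c w l.
Proof.
move=> c0 cw w0 wp; apply: integral_gt0 => //.
- exact: continuous_laplace_kernel.
- by move=> t /w0 wt; rewrite mulr_ge0 ?expR_ge0.
- by move=> t /wp wt; rewrite mulr_gt0 ?expR_gt0.
Qed.

Lemma laplace_suppE (c : R) (w : R -> R) (l : R) :
  (forall t, ~~ (0 < t < c) -> w t = 0) ->
  laplace c w l = fine (\int[mu]_t (w t * expR (- l * t))%:E).
Proof.
by move=> w0; rewrite (@integral_supp _ c)// => t /w0 ->; rewrite mul0r.
Qed.

Lemma laplace_suppW (c c' : R) (w : R -> R) (l : R) : c <= c' ->
  (forall t, ~~ (0 < t < c) -> w t = 0) -> laplace c' w l = laplace c w l.
Proof.
move=> cc' w0; rewrite !laplace_suppE// => t H; apply: w0.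
by apply: contra H => /andP[-> /lt_le_trans->].
Qed.

(** Substitution [s = a * t], carried out on the whole line, which the support condition on [w]
    permits. *)
Lemma laplace_scale (c a : R) (w : R -> R) (l : R) : 0 < a -> continuous w ->
  (forall t, 0 <= w t) -> (forall t, ~~ (0 < t < c) -> w t = 0) ->
  laplace (a * c) (fun s : R => w (s / a)) l = a * laplace c w (a * l).
Proof.
move=> a0 cw w0 ws.
rewrite (@laplace_suppE (a * c)); last first.
  move=> t H; apply: ws; apply: contra H => /andP[].
  by rewrite pmulr_lgt0 ?invr_gt0// => -> ; rewrite ltr_pdivrMr// mulrC => ->.
rewrite (@ge0_integral_affine _ 0 a) //; last 2 first.
- apply/measurable_EFinP; apply: continuous_measurable_fun => t.
  apply: (@continuous_laplace_kernel _ (fun s : R => w (s / a))) => s.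
  apply: (@continuous_comp _ _ _ (fun s : R => s / a) w); last exact: cw.
  by apply: cvgM; [exact: cvg_id|exact: cvg_cst].
- by move=> x; rewrite lee_fin mulr_ge0 ?expR_ge0.
under eq_integral => t _.
  rewrite add0r (_ : _ * _ = w t * expR (- (a * l) * t)); last first.
    by rewrite mulrAC divff ?gt_eqF// mul1r; congr (_ * expR _); ring.
  over.
rewrite (@integral_supp _ c)//; last by move=> t /ws ->; rewrite mul0r.
rewrite fineM//; apply: integrable_fin_num => //; exact: integrable_laplace.
Qed.

Variables (k : nat) (r V : R).
Hypotheses (r0 : 0 < r) (V0 : 0 < V).

Let v t := V * cap k r t.
Let tv t := t * v t.

Let cv : continuous v.
Proof. by move=> t; apply: cvgM; [exact: cvg_cst|exact: continuous_cap]. Qed.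

Let ctv : continuous tv.
Proof. by move=> t; apply: cvgM; [exact: cvg_id|exact: cv]. Qed.

Let v_ge0 t : 0 <= v t. Proof. by rewrite mulr_ge0 ?cap_ge0// ltW. Qed.

Let v_eq0 t : ~~ (0 < t < 2 * r) -> v t = 0.
Proof. by move=> H; rewrite /v cap_eq0 ?mulr0// ltW. Qed.

Let v_gt0 t : 0 < t < 2 * r -> 0 < v t.
Proof. by move=> H; rewrite mulr_gt0 ?cap_gt0. Qed.

Let tv_ge0 t : 0 <= tv t.
Proof.
have [/andP[t0 _]|/v_eq0 vt] := boolP (0 < t < 2 * r).
  by rewrite mulr_ge0 ?v_ge0 ?(ltW t0).
by rewrite /tv vt mulr0.
Qed.

Let tr0 : 0 < 2 * r. Proof. by rewrite mulr_gt0. Qed.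

Definition cap_mass (l : R) : R := laplace (2 * r) v l.
Definition cap_moment (l : R) : R := laplace (2 * r) tv l.

Lemma cap_mass_gt0 l : 0 < cap_mass l.
Proof. exact: laplace_gt0. Qed.

Lemma cap_moment_gt0 l : 0 < cap_moment l.
Proof.
by apply: laplace_gt0 => // t /[dup] /andP[t0 _] H; rewrite mulr_gt0 ?v_gt0.
Qed.

(** The difference is the transform of [(2 * r - t) * v t], positive inside the ball. *)
Lemma cap_moment_lt l : cap_moment l < 2 * r * cap_mass l.
Proof.
rewrite -subr_gt0 -laplaceZ// -laplaceB//; last first.
  by move=> t; apply: cvgM; [exact: cvg_cst|exact: cv].
apply: laplace_gt0 => //.
- move=> t; apply: cvgB; last exact: ctv.
  by apply: cvgM; [exact: cvg_cst|exact: cv].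
- by move=> t /andP[_ tr]; rewrite -mulrBl mulr_ge0// subr_ge0.
- by move=> t /[dup] /andP[_ tr] H; rewrite -mulrBl mulr_gt0 ?subr_gt0// v_gt0.
Qed.

Lemma is_derive_cap_mass (l : R) : is_derive l 1 cap_mass (- cap_moment l).
Proof. exact: is_derive_laplace. Qed.

Lemma continuous_cap_moment : continuous cap_moment.
Proof.
move=> l; apply: differentiable_continuous; apply/derivable1_diffP.
by have [] := is_derive_laplace (2 * r) l ctv.
Qed.

(* Both products are monotone in [t * (2 * r - t)]; after clearing denominators
   the difference is [2 r (s - x) (1 - 1 / a)] up to a nonnegative factor. *)
Let v_ratio (a x s : R) : 1 <= a -> 0 < x < 2 * r -> 0 <= s ->
  0 <= (s - x) * (v (s / a) * v x - v (x / a) * v s).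
Proof.
move=> a1 /andP[x0 xr] s0; have a0 : 0 < a by exact: lt_le_trans a1.
have ia : 0 <= 1 - a^-1 by rewrite subr_ge0 invf_le1.
pose p t := t * (2 * r - t).
have px : 0 <= p x by rewrite mulr_ge0 ?subr_ge0 ?ltW.
have xa : x / a <= x by rewrite ler_pdivrMr// ler_peMr ?(ltW x0).
have pxa : 0 <= p (x / a).
  by rewrite mulr_ge0 ?divr_ge0 ?subr_ge0 ?(ltW x0) ?(ltW a0)// (le_trans xa)// ltW.
have D : p x * p (s / a) - p (x / a) * p s =
    (x * s / a * (2 * r) * (1 - a^-1)) * (s - x).
  by rewrite /p; field; rewrite gt_eqF.
have xs : 0 <= x * s / a * (2 * r) * (1 - a^-1).
  by rewrite !mulr_ge0 ?invr_ge0 ?(ltW x0) ?(ltW a0) ?(ltW r0).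
have vE t s' : 0 <= p t -> v t * v s' = V ^+ 2 * Num.sqrt (p t * p s') ^+ k.+1.
  by move=> pt; rewrite sqrtrM// exprMn /v /cap /p; ring.
rewrite [v (s / a) * _]mulrC !vE// -mulrBr mulrCA mulr_ge0 ?sqr_ge0//.
have [sx|sx] := leP x s.
  rewrite mulr_ge0 ?subr_ge0// lerXn2r ?nnegrE ?sqrtr_ge0// ler_wsqrtr//.
  by rewrite -subr_ge0 D mulr_ge0// subr_ge0.
rewrite -mulrNN mulr_ge0 ?oppr_ge0 ?subr_le0 ?(ltW sx)//.
rewrite lerXn2r ?nnegrE ?sqrtr_ge0// ler_wsqrtr//.
by rewrite -subr_le0 D mulr_ge0_le0// subr_le0 ltW.
Qed.

(* Rescaling by [a = l2 / l1] turns the mean at [l2] into a mean against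
   [exp (- l1 s)]; the ratio of the two profiles is then nondecreasing in [s]. *)
Lemma cap_mean_mono (l1 l2 : R) : 0 < l1 -> l1 <= l2 ->
  l1 * cap_moment l1 * cap_mass l2 <= l2 * cap_moment l2 * cap_mass l1.
Proof.
move=> l10 l12; have l20 := lt_le_trans l10 l12.
pose a := l2 / l1; have a1 : 1 <= a by rewrite ler_pdivlMr// mul1r.
have a0 : 0 < a by rewrite divr_gt0.
have al : a * l1 = l2 by rewrite divfK ?gt_eqF.
(* The pivot for [v_ratio] is the mean height at [l1]: then [s - x] integrates to zero against
   [v s * expR (- l1 * s)]. *)
pose x := cap_moment l1 / cap_mass l1.
have m0 := cap_mass_gt0 l1.
have xI : 0 < x < 2 * r.
  by rewrite divr_gt0 ?cap_moment_gt0//= ltr_pdivrMr// cap_moment_lt.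
have tvs t : ~~ (0 < t < 2 * r) -> tv t = 0.
  by move=> /v_eq0 H; rewrite /tv H mulr0.
have E1 : laplace (a * (2 * r)) (fun s => v (s / a)) l1 = a * cap_mass l2.
  by rewrite (laplace_scale _ a0 cv v_ge0 v_eq0) al.
have E2 : laplace (a * (2 * r)) (fun s => tv (s / a)) l1 = a * cap_moment l2.
  by rewrite (laplace_scale _ a0 ctv tv_ge0 tvs) al.
(* As [a >= 1], the stretched interval contains the support of all four functions, so their
   transforms can share it. *)
have ra : 2 * r <= a * (2 * r) by rewrite ler_peMl// ltW.
have E3 : laplace (a * (2 * r)) v l1 = cap_mass l1 by exact: laplace_suppW.
have E4 : laplace (a * (2 * r)) tv l1 = cap_moment l1 by exact: laplace_suppW.
have cva : continuous (fun s : R => v (s / a)).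
  move=> s; apply: (@continuous_comp _ _ _ (fun s : R => s / a) v); last exact: cv.
  by apply: cvgM; [exact: cvg_id|exact: cvg_cst].
have ctva : continuous (fun s : R => tv (s / a)).
  move=> s; apply: (@continuous_comp _ _ _ (fun s : R => s / a) tv); last exact: ctv.
  by apply: cvgM; [exact: cvg_id|exact: cvg_cst].
have cZ (q : R) (w : R -> R) : continuous w -> continuous (fun t => q * w t).
  by move=> cw t; apply: cvgM; [exact: cvg_cst|exact: cw].
have cB (w1 w2 : R -> R) : continuous w1 -> continuous w2 -> continuous (fun t => w1 t - w2 t).
  by move=> cw1 cw2 t; apply: cvgB; [exact: cw1|exact: cw2].
have : 0 <= laplace (a * (2 * r)) (fun s =>
    (a * v x * tv (s / a) - x * v x * v (s / a)) -
    (v (x / a) * tv s - x * v (x / a) * v s)) l1.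
  apply: laplace_ge0 => s /andP[s0 _].
  have := v_ratio a1 xI s0; congr (_ <= _); rewrite /tv; field.
  by rewrite gt_eqF.
rewrite laplaceB; [|by apply: cB; exact: cZ|by apply: cB; exact: cZ].
rewrite laplaceB; [|exact: cZ|exact: cZ].
rewrite laplaceB; [|exact: cZ|exact: cZ].
rewrite (laplaceZ _ (a * v x) _ ctva) (laplaceZ _ (x * v x) _ cva).
rewrite (laplaceZ _ (v (x / a)) _ ctv) (laplaceZ _ (x * v (x / a)) _ cv) E1 E2 E3 E4.
have -> : v (x / a) * cap_moment l1 - x * v (x / a) * cap_mass l1 = 0.
  have xm : x * cap_mass l1 = cap_moment l1 by rewrite divfK ?gt_eqF.
  by rewrite -xm; ring.
rewrite subr0.
have -> : a * v x * (a * cap_moment l2) - x * v x * (a * cap_mass l2) =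
   a * v x * (a * cap_moment l2 - x * cap_mass l2) by ring.
have avx : 0 < a * v x by rewrite mulr_gt0 ?v_gt0.
rewrite (pmulr_rge0 _ avx) subr_ge0 /x /a.
by rewrite -(ler_pM2r (mulr_gt0 l10 m0)); congr (_ <= _); field; rewrite gt_eqF.
Qed.

End Profile.

(** * Exponential weights: total mass, mean heights, decay *)

Section ExponentialWeights.
Context {R : realType}.
Notation mu := (@lebesgue_measure R).

Lemma integral_exp_weight (l : R) : 0 < l ->
  (\int[mu]_(t in `[0%R, +oo[) (l * expR (- l * t))%:E = 1)%E.
Proof.
move=> l0; rewrite -(integral_exponential_pdf l0) integral_mkcond.
by apply: eq_integral => t _; rewrite /exponential_pdf !patchE; case: ifP.
Qed.

Lemma integral_height_exp_weight (l : R) : 0 < l ->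
  (\int[mu]_(t in `[0%R, +oo[) (t * (l * expR (- l * t)))%:E = (1 / l)%:E)%E.
Proof.
move=> l0.
pose F (t : R) := - (t + l^-1) * expR (- l * t).
have dF (t : R) : is_derive t 1 F (t * (l * expR (- l * t))).
  have d1 : is_derive t 1 (fun x : R => - l * x) (- l).
    by apply: is_derive_eq; rewrite /GRing.scale/= mulr1.
  have d2 := @is_derive1_comp _ expR (fun x : R => - l * x) t _ _ (is_derive_expR _) d1.
  have d3 : is_derive t 1 (fun x : R => - (x + l^-1)) (- 1).
    by apply: is_derive_eq; rewrite addr0.
  apply: (is_derive_eq (is_deriveM d3 d2)).
  by rewrite /GRing.scale/=; field; rewrite gt_eqF.
have cF : continuous F.
  move=> t; apply: differentiable_continuous; apply/derivable1_diffP.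
  by have [] := dF t.
rewrite (@ge0_continuous_FTC2y _ _ F 0 0).
- by rewrite /F -EFinB mulr0 expR0 !add0r mulr1 opprK mul1r.
- by move=> t t0; rewrite !mulr_ge0 ?expR_ge0// ltW.
- apply: continuous_subspaceT => t; apply: cvgM; first exact: cvg_id.
  by apply: (@continuous_laplace_kernel _ (cst l)) => ?; exact: cvg_cst.
(* Squeeze: [1 + l * t / 2 <= expR (l * t / 2)] bounds [(t + 1 / l) * expR (- l * t)] by
   [(2 / l) * expR (- (l * t / 2))]. *)
- have lim0 : 2 / l * expR (- (l / 2 * t)) @[t --> +oo] --> 0.
    rewrite -[X in _ --> X](mulr0 (2 / l)); apply: cvgM; first exact: cvg_cst.
    rewrite (_ : (fun t => expR (- (l / 2 * t))) =
      (fun z => expR (- z)) \o (fun t => l / 2 * t))//.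
    apply: (@cvg_comp _ _ _ _ _ _ (pinfty_nbhs R)); last exact: cvgr_expR.
    by apply: gt0_cvgMry; rewrite ?divr_gt0.
  apply: norm_cvg0; apply: (@squeeze_cvgr _ _ _ _ (cst 0) _ _ _ _ _ lim0); last exact: cvg_cst.
  near=> t; have t0 : 0 < t by near: t; exact: nbhs_pinfty_gt.
  have tl0 : 0 <= t + l^-1 by rewrite addr_ge0 ?invr_ge0 ?ltW.
  rewrite normr_ge0/= normrM normrN (ger0_norm tl0) (ger0_norm (expR_ge0 _)).
  have -> : - l * t = - (l / 2 * t) + - (l / 2 * t) by field.
  rewrite expRD mulrA ler_wpM2r ?expR_ge0// expRN ler_pdivrMr ?expR_gt0//.
  apply: (@le_trans _ _ (2 / l * (1 + l / 2 * t))).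
    rewrite -subr_ge0 (_ : _ - _ = l^-1); first by rewrite invr_ge0 ltW.
    by field; rewrite gt_eqF.
  by rewrite ler_pM2l ?divr_gt0// expR_ge1Dx.
- by move=> t _; have [] := dF t.
- by apply/cvg_at_right_filter; exact: cF.
- by move=> t _; rewrite derive1E (@derive_val _ _ _ _ _ _ _ (dF t)).
Unshelve. all: end_near. Qed.

Lemma laplace_le (c l X : R) (w : R -> R) : continuous w ->
  (forall t, 0 <= t -> 0 <= w t) ->
  (\int[mu]_(t in `[0%R, +oo[) (w t * expR (- l * t))%:E = X%:E)%E ->
  laplace c w l <= X.
Proof.
move=> cw w0 wX; rewrite -lee_fin -wX /laplace /Rintegral fineK; last first.
  by apply: integrable_fin_num => //; exact: integrable_laplace.
apply: ge0_subset_integral => //.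
- apply/measurable_EFinP; apply: (measurable_funS measurableT) => //.
  by apply: continuous_measurable_fun; exact: continuous_laplace_kernel.
- by move=> t; rewrite /= in_itv/= andbT lee_fin => t0; rewrite mulr_ge0 ?expR_ge0 ?w0.
- by move=> t; rewrite /= !in_itv/= andbT => /andP[].
Qed.

Section HeightMean.
Context d (T : measurableType d) (m : {measure set T -> \bar R}) (S : set T) (h : T -> R).
Hypothesis mS : measurable S.
Let f (l : R) x := l * expR (- l * h x).
Hypothesis if0 : forall l : R, 0 < l -> m.-integrable S (EFin \o f l).
Hypothesis if1 : forall l : R, 0 < l -> m.-integrable S (EFin \o (fun x => h x * f l x)).
Let I0 (l : R) := \int[m]_(x in S) f l x.
Let I1 (l : R) := \int[m]_(x in S) (h x * f l x).
Hypothesis I0_gt0 : forall l : R, 0 < l -> 0 < I0 l.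

(* With [c] the mean of [h] at [l1], [(h - c) (exp (- (l2 - l1) h) - exp (- (l2 - l1) c))]
   is nonpositive; integrate it against the weight at [l1]. *)
Lemma exp_mean_anti (l1 l2 : R) : 0 < l1 -> l1 <= l2 ->
  I1 l2 * I0 l1 <= I1 l1 * I0 l2.
Proof.
move=> l10 l12; have l20 := lt_le_trans l10 l12.
pose c := I1 l1 / I0 l1.
have cE : c * I0 l1 = I1 l1 by rewrite divfK// gt_eqF// I0_gt0.
pose K := expR (- ((l2 - l1) * c)).
(* The coefficients [l2] and [l1] clear the ratio of the two prefactors. After integration the
   bracket with [f l1] vanishes because [c] is the mean there. *)
have key x : 0 <= (K * l2) * (h x * f l1 x - c * f l1 x) - l1 * (h x * f l2 x - c * f l2 x).
  have -> : f l2 x = l2 / l1 * expR (- ((l2 - l1) * h x)) * f l1 x.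
    rewrite /f [RHS](_ : _ = l2 * (expR (- ((l2 - l1) * h x)) * expR (- l1 * h x))).
      by rewrite -expRD; congr (_ * expR _); ring.
    by field; rewrite gt_eqF.
  have -> : K * l2 * (h x * f l1 x - c * f l1 x) -
     l1 * (h x * (l2 / l1 * expR (- ((l2 - l1) * h x)) * f l1 x) -
     c * (l2 / l1 * expR (- ((l2 - l1) * h x)) * f l1 x)) =
     l2 * f l1 x * ((h x - c) * (K - expR (- ((l2 - l1) * h x)))).
    by field; rewrite gt_eqF.
  rewrite mulr_ge0//; first by rewrite !mulr_ge0 ?expR_ge0 ?ltW.
  have l21 : 0 <= l2 - l1 by rewrite subr_ge0.
  have [hc|hc] := leP c (h x).
    by rewrite mulr_ge0 ?subr_ge0// ler_expR lerN2 ler_wpM2l.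
  by rewrite mulr_le0 ?subr_le0 ?(ltW hc)// ler_expR lerN2 ler_wpM2l// ltW.
have iZ (q : R) (g : T -> R) : m.-integrable S (EFin \o g) ->
    m.-integrable S (EFin \o (fun x => q * g x)).
  by move=> ig; have := integrableZl mS q ig; apply: eq_integrable.
have iB (g1 g2 : T -> R) : m.-integrable S (EFin \o g1) -> m.-integrable S (EFin \o g2) ->
    m.-integrable S (EFin \o (fun x => g1 x - g2 x)).
  by move=> ig1 ig2; have := integrableB mS ig1 ig2; apply: eq_integrable.
have ic0 (l : R) : 0 < l -> m.-integrable S (EFin \o (fun x => c * f l x)).
  by move=> l0; exact/iZ/if0.
have ic (l : R) : 0 < l -> m.-integrable S (EFin \o (fun x => h x * f l x - c * f l x)).
  by move=> l0; apply: iB; [exact: if1|exact: ic0].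
have icZ (q l : R) : 0 < l ->
    m.-integrable S (EFin \o (fun x => q * (h x * f l x - c * f l x))).
  by move=> l0; exact/iZ/ic.
have icE (q l : R) : 0 < l ->
    \int[m]_(x in S) (q * (h x * f l x - c * f l x)) = q * (I1 l - c * I0 l).
  move=> l0; rewrite RintegralZl//; last exact: ic.
  rewrite RintegralB//; [|exact: if1|exact: ic0].
  by rewrite RintegralZl//; exact: if0.
have := Rintegral_ge0 m (fun x (_ : S x) => key x).
rewrite (RintegralB mS (icZ _ _ l10) (icZ _ _ l20)) (icE _ _ l10) (icE _ _ l20) cE subrr mulr0 sub0r oppr_ge0.
by rewrite pmulr_rle0// subr_le0 /c mulrAC ler_pdivlMr ?I0_gt0.
Qed.
End HeightMean.

(** The weight concentrates at the floor, where the slices shrink to zero: the profile is at most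
    [e / 2 + B * t], and the transforms of [l] and [t * l] at [l] are at most 1 and [1 / l]. *)
Lemma cap_mass_decay (k : nat) (r V e : R) : 0 < r -> 0 < V -> 0 < e ->
  exists2 L, 0 < L & forall l, L <= l -> l * cap_mass k r V l <= e.
Proof.
move=> r0 V0 e0.
pose K := V * Num.sqrt (2 * r) ^+ k * Num.sqrt (2 * r) ^+ k.+1.
have s0 : 0 < Num.sqrt (2 * r) by rewrite sqrtr_gt0 mulr_gt0.
have K0 : 0 < K by rewrite !mulr_gt0 ?exprn_gt0.
(* Chosen so that [e / 2 + B * s ^ 2 - K * s] is [(e - K * s) ^ 2 / (2 * e)], with [s] the square
   root of [t]. *)
pose B := K ^+ 2 / (2 * e).
have B0 : 0 < B by apply: divr_gt0; [exact: exprn_gt0|exact: mulr_gt0].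
have vle t : 0 <= t <= 2 * r -> V * cap k r t <= e / 2 + B * t.
  move=> /andP[t0 tr].
  have : V * cap k r t <= K * Num.sqrt t.
    rewrite /cap sqrtrM// exprMn exprS /K.
    have -> : V * Num.sqrt (2 * r) ^+ k * Num.sqrt (2 * r) ^+ k.+1 * Num.sqrt t =
      V * (Num.sqrt t * Num.sqrt (2 * r) ^+ k * Num.sqrt (2 * r) ^+ k.+1) by ring.
    rewrite ler_pM2l// -!mulrA ler_wpM2l ?sqrtr_ge0// ler_pM ?exprn_ge0 ?sqrtr_ge0//.
      by rewrite lerXn2r ?nnegrE ?sqrtr_ge0// ler_wsqrtr.
    by rewrite lerXn2r ?nnegrE ?sqrtr_ge0// ler_wsqrtr// gerBl.
  move/le_trans; apply.
  rewrite -{2}(sqr_sqrtr t0); set s := Num.sqrt t.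
  rewrite -subr_ge0 (_ : _ - _ = (e - K * s) ^+ 2 / (2 * e)).
    by rewrite divr_ge0 ?sqr_ge0// mulr_ge0 ?ltW.
  by rewrite /B; field; rewrite gt_eqF.
have B20 : 0 < 2 * B by exact: mulr_gt0.
exists (2 * B / e) => [|l]; first exact: divr_gt0.
rewrite ler_pdivrMr// => lL.
have l0 : 0 < l.
  by rewrite -(pmulr_lgt0 _ e0) (lt_le_trans B20 lL).
have cc (q : R) : continuous (fun _ : R => q) by move=> t; exact: cvg_cst.
have ccl (q : R) : continuous (fun t : R => t * q).
  by move=> t; apply: cvgM; [exact: cvg_id|exact: cvg_cst].
have cw : continuous (fun t : R => e / 2 + B * t).
  by move=> t; apply: cvgD; [exact: cvg_cst|apply: cvgM; [exact: cvg_cst|exact: cvg_id]].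
have cv : continuous (fun t : R => V * cap k r t).
  by move=> t; apply: cvgM; [exact: cvg_cst|exact: continuous_cap].
have H0 : laplace (2 * r) (cst l) l <= 1.
  apply: laplace_le; [exact: cc|by move=> *; exact: ltW|exact: integral_exp_weight].
have H1 : laplace (2 * r) (fun t => t * l) l <= 1 / l.
  apply: laplace_le; [exact: ccl|by move=> t t0; rewrite mulr_ge0// ltW|].
  rewrite -integral_height_exp_weight//; apply: eq_integral => t _.
  by rewrite mulrA.
rewrite /cap_mass -laplaceZ//.
have le1 : laplace (2 * r) (fun t => l * (V * cap k r t)) l <=
    e / 2 * laplace (2 * r) (cst l) l + B * laplace (2 * r) (fun t => t * l) l.
  have cA : continuous (fun t : R => e / 2 * cst l t) by move=> t; apply: cvgM; exact: cvg_cst.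
  have cB : continuous (fun t : R => B * (t * l)).
    by move=> t; apply: cvgM; [exact: cvg_cst|exact: ccl].
  have cAB : continuous (fun t : R => e / 2 * cst l t + B * (t * l)).
    by move=> t; apply: cvgD; [exact: cA|exact: cB].
  have clv : continuous (fun t : R => l * (V * cap k r t)).
    by move=> t; apply: cvgM; [exact: cvg_cst|exact: cv].
  rewrite -(laplaceZ _ (e / 2) _ (cc l)) -(laplaceZ _ B _ (ccl l)) -(laplaceD _ _ cA cB).
  rewrite -subr_ge0 -(laplaceB _ _ cAB clv).
  apply: laplace_ge0 => t /vle vt; rewrite subr_ge0.
  have -> : e / 2 * cst l t + B * (t * l) = l * (e / 2 + B * t) by rewrite /cst; ring.
  by rewrite ler_pM2l.
apply: (le_trans le1).
have e2 : e / 2 * laplace (2 * r) (cst l) l <= e / 2 by rewrite ler_piMr ?divr_ge0 ?(ltW e0).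
have B1 : B * laplace (2 * r) (fun t => t * l) l <= B * (1 / l) by rewrite ler_pM2l.
have Bl : B * (1 / l) <= e / 2 by rewrite mulrA mulr1 ler_pdivrMr//; lra.
by lra.
Qed.
End ExponentialWeights.

(** * Lebesgue measure on nested products *)

Section CoordinateSpace.
Context {R : realType}.
Notation mu := (@lebesgue_measure R).
Notation RRn n := (projT2 (RR R n)).

Lemma measurable_toRV n (i : 'I_n.+1) :
  measurable_fun setT (fun q : RRn n => toRV q ord0 i : R).
Proof.
elim: n i => [|n IH] i.
  by rewrite (_ : (fun q => _) = id)//; apply/funext => q; rewrite /= mxE.
have [j ij|ij] := unliftP ord_max i.
  rewrite (_ : (fun q => _) = (fun q => toRV q ord0 j : R) \o fst).
    by apply: measurableT_comp; [exact: IH|exact: measurable_fst].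
  by apply/funext => q; rewrite /= mxE ij liftK.
rewrite (_ : (fun q => _) = snd); first exact: measurable_snd.
by apply/funext => q; rewrite /= mxE ij unlift_none.
Qed.

Lemma measurable_ball_coord k (a : 'I_k.+1 -> R) (t : R) :
  measurable [set q : RRn k | \sum_i (toRV q ord0 i - a i) ^+ 2 < t].
Proof.
have mf : measurable_fun setT (fun q : RRn k => \sum_i (toRV q ord0 i - a i) ^+ 2 : R).
  apply: measurable_sum => i; apply: measurable_funX; apply: measurable_funB => //.
  exact: measurable_toRV.
rewrite (_ : [set q | _] = setT `&`
    (fun q : RRn k => \sum_i (toRV q ord0 i - a i) ^+ 2 : R) @^-1` `]-oo, t[); first exact: mf.
by rewrite setTI; apply/seteqP; split => q /=; rewrite in_itv.
Qed.

(** Bridges the topology of row vectors and the product sigma-algebra of [RR]: an open set is a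
    countable union of boxes with rational centres and radii [1 / k.+1], and a box is a finite
    intersection of coordinate conditions. *)
Lemma measurable_toRV_open n (U : set 'rV[R]_n.+1) :
  open U -> measurable (@toRV R n @^-1` U).
Proof.
move=> oU.
pose box (p : 'rV[rat]_n.+1 * nat) : set 'rV[R]_n.+1 :=
  [set x | forall i, `|x ord0 i - ratr (p.1 ord0 i)| < p.2.+1%:R^-1].
have -> : U = \bigcup_(p : 'rV[rat]_n.+1 * nat) (if `[< box p `<=` U >] then box p else set0).
  apply/seteqP; split => [x Ux|x [p _]]; last first.
    by case: asboolP => // pU; exact: pU.
  have /nbhs_ballP [e /= e0 xe] := open_nbhs_nbhs (conj oU Ux).
  have [k ke] : exists k : nat, k.+1%:R^-1 < e / 2.
    have [k _ /(_ k (leqnn k))] := near_infty_natSinv_lt (PosNum (divr_gt0 e0 (ltr0Sn R 1))).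
    by exists k.
  have [d dk] : exists d : R, d = k.+1%:R^-1 by exists k.+1%:R^-1.
  have d0 : 0 < d by rewrite dk invr_gt0 ltr0Sn.
  rewrite -dk in ke.
  have /fin_all_exists [q xq] : forall i : 'I_n.+1, exists q : rat, `|x ord0 i - ratr q| < d.
    move=> i; have lt_ends : x ord0 i - d < x ord0 i + d by lra.
    have [q] := rat_in_itvoo lt_ends.
    by rewrite in_itv/= => /andP[? ?]; exists q; rewrite ltr_distlC; apply/andP; split; lra.
  exists (\row_i q i, k) => //.
  rewrite asboolT; first by move=> i /=; rewrite mxE -dk.
  move=> y yb; apply: xe; split=> // i j; rewrite ord1 /ball/=.
  have := yb j; rewrite /= mxE -dk => yq.
  have -> : x ord0 j - y ord0 j = (x ord0 j - ratr (q j)) - (y ord0 j - ratr (q j)) by ring.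
  by apply: le_lt_trans (ler_normB _ _) _; have := xq j; lra.
rewrite preimage_bigcup; apply: countable_bigcupT_measurable => // p.
case: ifPn => _; last by rewrite preimage_set0.
rewrite (_ : _ @^-1` _ = \bigcap_(i in [set: 'I_n.+1])
  ((fun q : RRn n => toRV q ord0 i : R) @^-1` (ball (ratr (p.1 ord0 i) : R) p.2.+1%:R^-1))).
  apply: fin_bigcap_measurable => // i _; rewrite -[X in measurable X]setTI.
  by apply: measurable_toRV => //; exact: measurable_ball.
apply/seteqP; split => q /= H i; first by move=> _ /=; rewrite /ball/= distrC; exact: H.
by have := H i I; rewrite /ball/= distrC.
Qed.

(** [leb] is typed as a bare measure, whereas Tonelli needs a sigma-finite structure; the equation
    in the conclusion lets one be rewritten into the other. *)
Lemma sigma_finite_pack d (T : measurableType d) (m : {measure set T -> \bar R}) :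
  sigma_finite setT m ->
  exists s : {sigma_finite_measure set T -> \bar R}, (s : {measure set T -> \bar R}) = m.
Proof.
case: m => f c sf; pose m := Measure.Pack c.
pose s : {sigma_finite_measure set T -> \bar R} :=
  HB.pack f m (@Measure_isSigmaFinite.Build _ _ _ m sf).
by exists s; rewrite /s; congr Measure.Pack.
Qed.

(** Both exhausting sequences are nondecreasing, so the index [maxn k l] serves the two coordinates
    at once. *)
Lemma leb_sigma_finite n : sigma_finite setT (leb R n).
Proof.
elim: n => [|n /sigma_finiteP[F [TF ndF Foo]]]; first exact: (@sigma_finiteT _ _ _ mu).
have /sigma_finiteP[G [TG ndG Goo]] : sigma_finite setT mu by exact: sigma_finiteT.
exists (fun k => F k `*` G k).
  rewrite -setXTT TF TG; apply/seteqP; split => -[x y]; last first.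
    by move=> [k _ []/= ? ?]; split; exists k.
  move=> [/= [k _ Fx] [l _ Gy]]; exists (maxn k l) => //; split.
    by move: x Fx; exact/subsetPset/ndF/leq_maxl.
  by move: y Gy; exact/subsetPset/ndG/leq_maxr.
move=> k; have [mF Fk] := Foo k; have [mG Gk] := Goo k.
split; first exact: measurableX.
by rewrite /= product_measure1E// lte_mul_pinfty// ge0_fin_numE.
Qed.

(** Tonelli with the height integrated last: the weight is constant on each horizontal slice and
    leaves the inner integral. *)
Lemma integral_slices n (S : set (RRn n.+1)) (h : R -> R) :
  measurable S -> measurable_fun setT h -> (forall r, 0 <= h r) ->
  (\int[leb R n.+1]_(p in S) (h p.2)%:E =
   \int[mu]_r ((h r)%:E * leb R n (ysection S r)))%E.
Proof.
move=> mS mh h0.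
have [s sE] := sigma_finite_pack (leb_sigma_finite n).
rewrite /= -sE.
pose f (p : RRn n * R) := ((h p.2)%:E * (\1_S p)%:E)%E.
have mf : measurable_fun setT f.
  apply: emeasurable_funM; apply/measurable_EFinP => //.
  by apply: measurableT_comp => //; exact: measurable_snd.
transitivity (\int[(s \x mu)%E]_p f p)%E.
  rewrite integral_mkcond; apply: eq_integral => p _.
  by rewrite /f patchE indicE; case: ifP => _; rewrite ?mule1 ?mule0.
rewrite fubini_tonelli2//; last first.
  by move=> p; rewrite /f mule_ge0 ?lee_fin.
apply: eq_integral => r _; rewrite /fubini_G/f/=.
rewrite ge0_integralZl//.
- congr (_ * _)%E.
  rewrite -[in RHS](setIT (ysection S r)) -integral_indic//; last exact: measurable_ysection.
  by apply: eq_integral => x _; rewrite !indicE /ysection mem_setE.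
- apply/measurable_EFinP.
  apply: (@measurableT_comp _ _ _ _ _ _ (\1_S : RRn n * R -> R) _ (fun x => (x, r))).
    exact: measurable_indic.
  by apply: pair2_measurable.
- by rewrite lee_fin.
Qed.

(* [Num.sqrt] vanishes on negative numbers, so this also covers [t <= 0]. *)
Lemma leb_ball n : exists2 V : R, 0 < V & forall (a : 'I_n.+1 -> R) (t : R),
  leb R n [set q | \sum_i (toRV q ord0 i - a i) ^+ 2 < t] =
  (V * Num.sqrt t ^+ n.+1)%:E.
Proof.
elim: n => [|n [V V0 IH]].
  exists 2 => // a t.
  have [t0|t0] := leP t 0.
    rewrite ler0_sqrtr// expr1 mulr0.
    rewrite (_ : [set q | _] = set0) ?measure0//; apply/seteqP; split => q //=.
    by rewrite big_ord1 ltNge (le_trans t0)// sqr_ge0.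
  have -> : [set q : RRn 0 | \sum_i (toRV q ord0 i - a i) ^+ 2 < t] =
     `]a ord0 - Num.sqrt t, a ord0 + Num.sqrt t[%classic.
    apply/seteqP; split => q /=; rewrite big_ord1 mxE in_itv/=.
      by rewrite -ltr_sqrt// sqrtr_sqr ltr_distl.
    by rewrite -ltr_distl -sqrtr_sqr ltr_sqrt.
  rewrite /= lebesgue_measure_itv/= lte_fin.
  have -> : a ord0 - Num.sqrt t < a ord0 + Num.sqrt t.
    by have : 0 < Num.sqrt t; [rewrite sqrtr_gt0|move=> ?; lra].
  by rewrite -EFinB; congr EFin; ring.
(* Volume of the unit ball resting at height 0, computed from its slices [V * cap n 1]. *)
exists (\int[mu]_(t in `[0, 2 * 1]) (V * cap n 1 t)).
  apply: integral_gt0; first by rewrite mulr1.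
  - by move=> t; apply: cvgM; [exact: cvg_cst|exact: continuous_cap].
  - by move=> t _; rewrite mulr_ge0 ?cap_ge0 ?ltW.
  - by move=> t tI; rewrite mulr_gt0 ?cap_gt0.
move=> a t.
set S := (X in leb R n.+1 X).
have mS : measurable S by exact: measurable_ball_coord.
pose b i := a (lift ord_max i).
have slice r : leb R n (ysection S r) =
    (V * Num.sqrt (t - (r - a ord_max) ^+ 2) ^+ n.+1)%:E.
  rewrite -(IH b); congr (leb R n _); rewrite ysectionE.
  have sumE (q : RRn n) : \sum_(i < n.+2) (toRV ((q, r) : RRn n.+1) ord0 i - a i) ^+ 2 =
      \sum_i (toRV q ord0 i - b i) ^+ 2 + (r - a ord_max) ^+ 2.
    rewrite big_ord_recr/= mxE unlift_none; congr (_ + _); apply: eq_bigr => i _.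
    have -> : widen_ord (leqnSn n.+1) i = lift ord_max i.
      by apply: val_inj; rewrite /= /bump leqNgt ltn_ord.
    by rewrite mxE liftK.
  by apply/seteqP; split => q /=; rewrite /S/= sumE ltrBrDr.
transitivity (\int[leb R n.+1]_(p in S) (cst 1 p.2)%:E)%E.
  by rewrite (eq_integral (cst 1%E))// integral_cst// mul1e.
rewrite integral_slices//.
under eq_integral do rewrite slice mul1e.
have [t0|t0] := leP t 0.
  rewrite (ler0_sqrtr t0) expr0n/= mulr0 integral0_eq// => r _.
  by rewrite ler0_sqrtr ?expr0n/= ?mulr0// subr_le0 (le_trans t0)// sqr_ge0.
have s0 : 0 < Num.sqrt t by rewrite sqrtr_gt0.
(* Rescales to the unit ball on the floor: the slices contribute [n.+1] factors [Num.sqrt t], the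
   substitution one more. *)
rewrite (@ge0_integral_affine _ (a ord_max - Num.sqrt t) (Num.sqrt t))//.
- under eq_integral => z _.
    rewrite (_ : V * _ = Num.sqrt t ^+ n.+1 * (V * cap n 1 z)); last first.
      rewrite mulrCA; congr (_ * _); rewrite -exprMn -sqrtrM ?(ltW t0)//.
      congr (Num.sqrt _ ^+ _).
      rewrite -[X in X - _](sqr_sqrtr (ltW t0)) -[X in _ = X * _](sqr_sqrtr (ltW t0)).
      by ring.
    rewrite EFinM.
    over.
  rewrite ge0_integralZl//=.
  + by rewrite integral_cap_fin// -!EFinM; congr EFin; rewrite mulrA -exprS mulrC.
  + apply/measurable_EFinP; apply: continuous_measurable_fun => z.
    by apply: cvgM; [exact: cvg_cst|exact: continuous_cap].
  + by move=> z _; rewrite lee_fin mulr_ge0 ?cap_ge0 ?ltW.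
- apply/measurable_EFinP; apply: continuous_measurable_fun => z.
  apply: cvgM; first exact: cvg_cst.
  apply: (@continuous_comp _ _ _ (fun z : R => Num.sqrt (t - (z - a ord_max) ^+ 2))
    (fun x : R => x ^+ n.+1)); last exact: exprn_continuous.
  apply: (@continuous_comp _ _ _ (fun z : R => t - (z - a ord_max) ^+ 2) Num.sqrt);
    last exact: sqrt_continuous.
  apply: cvgB; first exact: cvg_cst.
  apply: (@continuous_comp _ _ _ (fun z : R => z - a ord_max) (fun x : R => x ^+ 2));
    last exact: exprn_continuous.
  by apply: cvgB; [exact: cvg_id|exact: cvg_cst].
- by move=> r; rewrite lee_fin mulr_ge0 ?exprn_ge0 ?sqrtr_ge0 ?ltW.
Qed.
End CoordinateSpace.

(** * Integrals over the cylinder *)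

Section Cylinder.
Context {R : realType}.
Notation mu := (@lebesgue_measure R).
Notation RRn n := (projT2 (RR R n)).
Variables (n : nat) (Db : set 'rV[R]_n.+1) (r V : R) (x : 'rV[R]_n.+1).
Hypotheses (r0 : 0 < r) (V0 : 0 < V) (oDb : open Db) (bDb : bounded_set Db).
Hypothesis xD : Dbprime Db r x.
Hypothesis ballV : forall (a : 'I_n.+1 -> R) (t : R),
  leb R n [set q | \sum_i (toRV q ord0 i - a i) ^+ 2 < t] =
  (V * Num.sqrt t ^+ n.+1)%:E.

Let SB (y : R) : set (RRn n.+1) := @toPt R n @^-1` Ball (x, y) r.
Let SD : set (RRn n.+1) := @toPt R n @^-1` cyl Db.

Definition base_area : R := fine (leb R n (@toRV R n @^-1` Db)).
Let A := base_area.

Let SBE y : SB y = [set p : RRn n * R |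
  \sum_i (toRV p.1 ord0 i - x ord0 i) ^+ 2 + (p.2 - y) ^+ 2 < r ^+ 2].
Proof.
apply/seteqP; split => p; rewrite /SB /Ball /edist /toPt /=.
  by rewrite -[ltRHS](gtr0_norm r0) -sqrtr_sqr ltr_sqrt// exprn_gt0.
by rewrite -[X in _ -> _ < X](gtr0_norm r0) -sqrtr_sqr ltr_sqrt// exprn_gt0.
Qed.

Let mSB y : measurable (SB y).
Proof.
pose f (p : RRn n * R) : R := \sum_i (toRV p.1 ord0 i - x ord0 i) ^+ 2 + (p.2 - y) ^+ 2.
have mf : measurable_fun setT f.
  apply: measurable_funD.
    apply: measurable_sum => i; apply: measurable_funX; apply: measurable_funB => //.
    apply: (@measurableT_comp _ _ _ _ _ _ (fun q : RRn n => toRV q ord0 i : R) _ fst).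
      exact: measurable_toRV.
    exact: measurable_fst.
  by apply: measurable_funX; apply: measurable_funB => //; exact: measurable_snd.
have -> : SB y = setT `&` f @^-1` `]-oo, r ^+ 2[.
  by rewrite SBE setTI; apply/seteqP; split => p /=; rewrite in_itv.
exact: mf.
Qed.

Let mDb : measurable (@toRV R n @^-1` Db).
Proof. exact: measurable_toRV_open. Qed.

Let SDE : SD = (@toRV R n @^-1` Db) `*` `[0, +oo[.
Proof.
by apply/seteqP; split => -[q t]; rewrite /SD /cyl /toPt /= in_itv/= andbT.
Qed.

Let mSD : measurable SD.
Proof. by rewrite SDE; exact: measurableX. Qed.

(** [Dbprime] speaks only of centres strictly above [r], so point and ball are lifted by 1;
    membership in the base ignores height, and [0 <= p.2] comes from [r <= y]. *)
Let SB_sub y : r <= y -> SB y `<=` SD.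
Proof.
move=> ry p; rewrite SBE /= => H.
have p2 : 0 <= p.2.
  have Hp : (p.2 - y) ^+ 2 < r ^+ 2.
    by apply: le_lt_trans H; rewrite lerDr sumr_ge0// => i _; exact: sqr_ge0.
  rewrite leNgt; apply/negP => p0; move: Hp; apply/negP; rewrite -leNgt -opprB sqrrN.
  have rp : r <= y - p.2 by rewrite lerBrDr (le_trans _ ry)// gerDl ltW.
  by rewrite lerXn2r ?nnegrE ?(le_trans _ rp) ?(ltW r0).
have [_ /(_ (y + 1))] := xD.
have ry1 : r < y + 1 by lra.
move=> /(_ ry1 (toRV p.1, p.2 + 1)) Hb; split => //.
have [] // : cyl Db (toRV p.1, p.2 + 1); apply: Hb.
rewrite /Ball /edist/= -[ltRHS](gtr0_norm r0) -sqrtr_sqr ltr_sqrt ?exprn_gt0//.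
by rewrite (_ : p.2 + 1 - (y + 1) = p.2 - y)//; ring.
Qed.

(** A bounded set lies in a Euclidean ball, whose measure is finite by [ballV]. *)
Let A_fin : leb R n (@toRV R n @^-1` Db) = A%:E.
Proof.
rewrite /A /base_area fineK// ge0_fin_numE ?measure_ge0//.
have [M [Mr HM]] := bDb.
pose C := Num.max 0 M + 1.
have MC : M < C by rewrite ltr_pwDr// le_max lexx orbT.
have C0 : 0 <= C by rewrite addr_ge0// le_max lexx.
have DC z : Db z -> `|z| <= C by exact: HM.
apply: (@le_lt_trans _ _ (leb R n
    [set q | \sum_i (toRV q ord0 i - (fun=> 0) i) ^+ 2 < n.+2%:R * C ^+ 2 + 1])).
  apply: le_measure; rewrite ?inE//; first exact: measurable_ball_coord.
  move=> q /DC qC /=.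
  apply: (@le_lt_trans _ _ (\sum_(i < n.+1) C ^+ 2)).
    apply: ler_sum => i _; rewrite subr0 -real_normK ?num_real//.
    rewrite lerXn2r ?nnegrE//; apply: le_trans qC.
    rewrite [leRHS]mx_normrE.
    exact: (le_bigmax _ (fun ij => `|toRV q ij.1 ij.2|) (ord0, i)).
  rewrite sumr_const card_ord -[C ^+ 2 *+ _]mulr_natl ltr_pwDr//.
  by rewrite ler_wpM2r ?sqr_ge0// ler_nat.
by rewrite ballV ltry.
Qed.

(** A horizontal slice of a ball contained in the cylinder projects into the base. *)
Let cap_le_area t : V * cap n r t <= A.
Proof.
have [tI|tI] := boolP (0 < t < 2 * r); last first.
  by rewrite cap_eq0 ?mulr0 ?fine_ge0// ltW.
rewrite -lee_fin -A_fin -(ballV (fun i => x ord0 i)).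
apply: le_measure; rewrite ?inE//; first exact: measurable_ball_coord.
move=> q /= H.
have ry : r <= r + r by rewrite lerDl ltW.
have [] // : SD (q, t + r); apply: (SB_sub ry).
rewrite SBE /= (_ : t + r - (r + r) = t - r); last by ring.
by rewrite -ltrBrDr; apply: lt_le_trans H _; rewrite le_eqVlt; apply/orP; left; apply/eqP; ring.
Qed.

Let A_gt0 : 0 < A.
Proof.
apply: lt_le_trans (cap_le_area r).
by rewrite mulr_gt0 ?cap_gt0// r0/= ltr_pMl// ltr1n.
Qed.

Let integral_SD (h : R -> R) (X : R) : measurable_fun setT h -> (forall t, 0 <= h t) ->
  (\int[mu]_(t in `[0%R, +oo[) (h t)%:E = X%:E)%E ->
  (\int[leb R n.+1]_(p in SD) (h p.2)%:E = (A * X)%:E)%E.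
Proof.
move=> mh h0 hX; rewrite integral_slices//.
rewrite EFinM -hX -ge0_integralZl//; last 3 first.
- by apply/measurable_EFinP; exact: measurable_funTS.
- by move=> t _; rewrite lee_fin.
- by rewrite lee_fin ltW.
rewrite [RHS]integral_mkcond; apply: eq_integral => t _; rewrite patchE.
case: ifPn => tI; rewrite SDE.
  by rewrite in_ysectionX// [X in (_ * X)%E]A_fin muleC.
by rewrite notin_ysectionX// measure0 mule0.
Qed.

(** On the right [t] is the height above the lowest point of the ball, which lies at [y - r]; the
    slice there has squared radius [t * (2 * r - t)]. *)
Let integral_SB (y : R) (h : R -> R) : measurable_fun setT h -> (forall t, 0 <= h t) ->
  (\int[leb R n.+1]_(p in SB y) (h p.2)%:E =
   \int[mu]_(t in `[0%R, (2 * r)%R]) (h (y - r + t) * (V * cap n r t))%:E)%E.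
Proof.
move=> mh h0; rewrite integral_slices//.
transitivity (\int[mu]_t (h t * (V * cap n r (t - (y - r))))%:E)%E.
  apply: eq_integral => t _; rewrite EFinM; congr (_ * _)%E.
  rewrite ysectionE.
  have -> : pair^~ t @^-1` SB y =
      [set q : RRn n | \sum_i (toRV q ord0 i - x ord0 i) ^+ 2 < r ^+ 2 - (t - y) ^+ 2].
    by rewrite SBE; apply/seteqP; split => q /=; rewrite ltrBrDr.
  by rewrite ballV /cap; congr (_ * Num.sqrt _ ^+ _)%:E; ring.
rewrite (@ge0_integral_affine _ (y - r) 1)//.
- rewrite mul1e; under eq_integral => t _.
    rewrite mul1r (addrC (y - r) t) addrK addrC; over.
  apply: integral_supp => t tI.
  by rewrite cap_eq0 ?mulr0// ltW.
- apply/measurable_EFinP; apply: measurable_funM => //.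
  apply: continuous_measurable_fun => t; apply: cvgM; first exact: cvg_cst.
  apply: (@continuous_comp _ _ _ (fun t : R => t - (y - r)) (cap n r)); last exact: continuous_cap.
  by apply: cvgB; [exact: cvg_id|exact: cvg_cst].
- by move=> t; rewrite lee_fin mulr_ge0// mulr_ge0 ?cap_ge0 ?ltW.
Qed.

Let w (l t : R) : R := l * expR (- l * t).

Let mw (l : R) : measurable_fun setT (w l).
Proof.
apply: continuous_measurable_fun; apply: (@continuous_laplace_kernel _ (cst l)).
by move=> ?; exact: cvg_cst.
Qed.

Let mwt (l : R) : measurable_fun setT (fun t : R => `|t| * w l t).
Proof. by apply: measurable_funM => //; exact: measurable_normr. Qed.

Let w_ge0 (l t : R) : 0 < l -> 0 <= w l t.
Proof. by move=> l0; rewrite mulr_ge0 ?expR_ge0// ltW. Qed.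

(** The absolute value makes the integrand nonnegative on the whole line, as [integral_slices]
    demands, and changes nothing inside the cylinder. *)
Let heightE (S : set (RRn n.+1)) (l : R) : S `<=` SD ->
  (\int[leb R n.+1]_(p in S) (p.2 * w l p.2)%:E =
   \int[leb R n.+1]_(p in S) (`|p.2| * w l p.2)%:E)%E.
Proof.
move=> SSD; apply: eq_integral => p; rewrite inE => /SSD [_ p2].
by rewrite ger0_norm.
Qed.

Let integral_SD0 (l : R) : 0 < l ->
  (\int[leb R n.+1]_(p in SD) (w l p.2)%:E = A%:E)%E.
Proof.
move=> l0; rewrite (@integral_SD (w l) 1) ?mulr1// => [t|].
  exact: w_ge0.
exact: integral_exp_weight.
Qed.

Let integral_SD1 (l : R) : 0 < l ->
  (\int[leb R n.+1]_(p in SD) (p.2 * w l p.2)%:E = (A / l)%:E)%E.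
Proof.
move=> l0; rewrite heightE//.
rewrite (@integral_SD (fun t => `|t| * w l t) (1 / l)) ?mul1r// => [t|].
  by rewrite mulr_ge0 ?w_ge0.
rewrite -[l^-1]mul1r -integral_height_exp_weight//; apply: eq_integral => t.
by rewrite inE /= in_itv/= andbT => t0; rewrite ger0_norm.
Qed.

Let b := cap_mass n r V.
Let b1 := cap_moment n r V.

Let cV : continuous (fun t : R => V * cap n r t).
Proof. by move=> t; apply: cvgM; [exact: cvg_cst|exact: continuous_cap]. Qed.

Let ctV : continuous (fun t : R => t * (V * cap n r t)).
Proof. by move=> t; apply: cvgM; [exact: cvg_id|exact: cV]. Qed.

Let integral_SB0 (y l : R) : 0 < l ->
  (\int[leb R n.+1]_(p in SB y) (w l p.2)%:E =
   (l * expR (- (l * (y - r))) * b l)%:E)%E.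
Proof.
move=> l0; rewrite (@integral_SB y (w l))//; last by move=> t; exact: w_ge0.
rewrite /b /cap_mass -laplaceZ//.
rewrite /laplace /Rintegral fineK; last first.
  apply: integrable_fin_num => //; apply: integrable_laplace => t.
  by apply: cvgM; [exact: cvg_cst|exact: cV].
apply: eq_integral => t _; congr EFin; rewrite /w.
rewrite (_ : - l * (y - r + t) = - (l * (y - r)) + - l * t); last by ring.
by rewrite expRD; ring.
Qed.

Let integral_SB1 (y l : R) : r <= y -> 0 < l ->
  (\int[leb R n.+1]_(p in SB y) (p.2 * w l p.2)%:E =
   (l * expR (- (l * (y - r))) * (b1 l + (y - r) * b l))%:E)%E.
Proof.
move=> ry l0; rewrite heightE; last exact: SB_sub.
rewrite (@integral_SB y (fun t => `|t| * w l t))//; last first.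
  by move=> t; rewrite mulr_ge0 ?w_ge0.
pose q := l * expR (- (l * (y - r))).
have c1 : continuous (fun t : R => (y - r) * (V * cap n r t)).
  by move=> t; apply: cvgM; [exact: cvg_cst|exact: cV].
have c2 : continuous (fun t : R => t * (V * cap n r t) + (y - r) * (V * cap n r t)).
  by move=> t; apply: cvgD; [exact: ctV|exact: c1].
rewrite -/q /b1 /b /cap_mass /cap_moment -(laplaceZ _ (y - r) _ cV).
rewrite -(laplaceD _ _ ctV c1) -(laplaceZ _ q _ c2).
rewrite /laplace /Rintegral fineK; last first.
  apply: integrable_fin_num => //; apply: integrable_laplace => t.
  by apply: cvgM; [exact: cvg_cst|exact: c2].
apply: eq_integral => t; rewrite inE /= in_itv/= => /andP[t0 _]; congr EFin.
rewrite ger0_norm; last by rewrite addr_ge0// subr_ge0.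
rewrite /w (_ : - l * (y - r + t) = - (l * (y - r)) + - l * t); last by ring.
by rewrite expRD /q; ring.
Qed.

Let iSD (h : R -> R) (X : R) : measurable_fun setT h ->
  (forall t, 0 <= t -> 0 <= h t) ->
  (\int[leb R n.+1]_(p in SD) (h p.2)%:E = X%:E)%E ->
  (leb R n.+1).-integrable SD (EFin \o (fun p : RRn n * R => h p.2)).
Proof.
move=> mh h0 hX; apply/integrableP; split.
  apply/measurable_EFinP; apply: (measurable_funS measurableT) => //.
  by apply: (measurableT_comp mh); exact: measurable_snd.
apply: (@le_lt_trans _ _ X%:E); last exact: ltry.
rewrite -hX le_eqVlt; apply/orP; left; apply/eqP; apply: eq_integral => p.
by rewrite inE => -[_ p2] /=; rewrite ger0_norm ?h0.
Qed.

Let iSD0 (l : R) : 0 < l ->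
  (leb R n.+1).-integrable SD (EFin \o (fun p : RRn n * R => w l p.2)).
Proof. by move=> l0; apply: iSD (integral_SD0 l0) => // t _; exact: w_ge0. Qed.

Let iSD1 (l : R) : 0 < l ->
  (leb R n.+1).-integrable SD (EFin \o (fun p : RRn n * R => p.2 * w l p.2)).
Proof.
move=> l0; apply: (@iSD (fun t => t * w l t) _ _ _ (integral_SD1 l0)).
  by apply: measurable_funM.
by move=> t t0; rewrite mulr_ge0// w_ge0.
Qed.

Let setD_integral (y : R) (h : RRn n * R -> R) (X Y : R) : r <= y ->
  (leb R n.+1).-integrable SD (EFin \o h) ->
  (\int[leb R n.+1]_(p in SD) (h p)%:E = X%:E)%E ->
  (\int[leb R n.+1]_(p in SB y) (h p)%:E = Y%:E)%E ->
  \int[leb R n.+1]_(p in SD `\` SB y) h p = X - Y.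
Proof.
move=> ry ih hX hY.
have : \int[leb R n.+1]_(p in SD) h p =
    \int[leb R n.+1]_(p in SB y) h p + \int[leb R n.+1]_(p in SD `\` SB y) h p.
  rewrite -{1}(setDUK (SB_sub ry)) Rintegral_setU//.
  - exact: measurableD.
  - by rewrite setDUK//; exact: SB_sub.
  - by apply/disj_set2P; exact: setDIK.
by rewrite /Rintegral hX hY /= => ->; rewrite addrC addKr.
Qed.

Lemma intRd_ball (y l : R) : 0 < l ->
  intRd (Ball (x, y) r) (fun p => l * expR (- l * p.2)) =
  l * expR (- (l * (y - r))) * cap_mass n r V l.
Proof. by move=> l0; rewrite /intRd /Rintegral [X in fine X]integral_SB0. Qed.

Lemma intRd_outside (y l : R) : r <= y -> 0 < l ->
  intRd (cyl Db `\` Ball (x, y) r) (fun p => l * expR (- l * p.2)) =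
  base_area - l * expR (- (l * (y - r))) * cap_mass n r V l.
Proof.
move=> ry l0; apply: (setD_integral ry (iSD0 l0) (integral_SD0 l0)).
exact: integral_SB0.
Qed.

Lemma intRd_height_outside (y l : R) : r <= y -> 0 < l ->
  intRd (cyl Db `\` Ball (x, y) r) (fun p => p.2 * (l * expR (- l * p.2))) =
  base_area / l -
  l * expR (- (l * (y - r))) * (cap_moment n r V l + (y - r) * cap_mass n r V l).
Proof.
move=> ry l0; apply: (setD_integral ry (iSD1 l0) (integral_SD1 l0)).
exact: integral_SB1.
Qed.

Lemma intRd_height_outside_ge0 (y l : R) : 0 < l ->
  0 <= intRd (cyl Db `\` Ball (x, y) r) (fun p => p.2 * (l * expR (- l * p.2))).
Proof.
by move=> l0; apply: Rintegral_ge0 => p [[_ p2] _] /=; rewrite mulr_ge0// w_ge0.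
Qed.

(** Slices have area at most [A], and strictness holds because the exponential law gives
    [[0, 2 * r]] probability less than 1. *)
Lemma cap_mass_lt_area (l : R) : 0 < l -> l * cap_mass n r V l < base_area.
Proof.
move=> l0.
have cc (q : R) : continuous (fun _ : R => q) by move=> t; exact: cvg_cst.
apply: (@le_lt_trans _ _ (A * (l * laplace (2 * r) (cst 1) l))).
  rewrite mulrCA ler_pM2l// -laplaceZ; last exact: cc.
  have c1 : continuous (fun t : R => A * cst 1 t) by rewrite /cst; exact: cc.
  rewrite -subr_ge0 /cap_mass -(laplaceB _ _ c1 cV).
  by apply: laplace_ge0 => t _; rewrite subr_ge0 mulr1 cap_le_area.
rewrite gtr_pMr ?A_gt0//.
have r20 : 0 < 2 * r by rewrite mulr_gt0.
have := exponential_prob_itv0c l r20.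
have pdfE : exponential_prob l `[0, 2 * r] =
    (\int[mu]_(t in `[0%R, (2 * r)%R]) (l * expR (- l * t))%:E)%E.
  apply: eq_integral => t; rewrite inE /= in_itv/= => /andP[t0 _].
  by rewrite /exponential_pdf patchE mem_set//= in_itv/= t0.
rewrite pdfE => H; rewrite -laplaceZ; last exact: cc.
rewrite /laplace /Rintegral; under eq_integral do rewrite /cst mulr1.
by rewrite H /= ltrBlDr ltrDl expR_gt0.
Qed.

(** For [y = r] all four factors are integrals over one fixed set, the cylinder without the ball, so
    [exp_mean_anti] applies. *)
Lemma mean_height_anti (l1 l2 : R) : 0 < l1 -> l1 <= l2 ->
  (base_area / l2 - l2 * cap_moment n r V l2) * (base_area - l1 * cap_mass n r V l1) <=
  (base_area / l1 - l1 * cap_moment n r V l1) * (base_area - l2 * cap_mass n r V l2).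
Proof.
move=> l10 l12; have l20 := lt_le_trans l10 l12.
have I0E l : 0 < l -> base_area - l * cap_mass n r V l =
    \int[leb R n.+1]_(p in SD `\` SB r) (l * expR (- l * p.2)).
  move=> l0; rewrite [RHS](intRd_outside (lexx r) l0).
  by rewrite subrr mulr0 oppr0 expR0 mulr1.
have I1E l : 0 < l -> base_area / l - l * cap_moment n r V l =
    \int[leb R n.+1]_(p in SD `\` SB r) (p.2 * (l * expR (- l * p.2))).
  move=> l0; rewrite [RHS](intRd_height_outside (lexx r) l0).
  by rewrite subrr mulr0 oppr0 expR0 mulr1 mul0r addr0.
have mS : measurable (SD `\` SB r) by exact: measurableD.
rewrite (I0E _ l10) (I0E _ l20) (I1E _ l10) (I1E _ l20).
apply: (@exp_mean_anti _ _ _ (leb R n.+1) _ (fun p : RRn n * R => p.2) mS) => // l l0.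
- by apply: (integrableS mSD mS _ (iSD0 l0)); exact: subDsetl.
- by apply: (integrableS mSD mS _ (iSD1 l0)); exact: subDsetl.
- by rewrite -I0E// subr_gt0 cap_mass_lt_area.
Qed.

Lemma base_area_gt0 : 0 < base_area. Proof. exact: A_gt0. Qed.

End Cylinder.

(** * From the geometric integrals to the equilibrium equations *)

Unset Implicit Arguments. Set Strict Implicit. Set Printing Implicit Defensive.

(* d = n.+2, so R^(d-1) = 'rV_(n.+1) *)
Theorem theorem2p2 (R : realType) (n : nat) (Db : set 'rV[R]_(n.+1))
  (Rr m M g E : R) (xt : 'rV[R]_(n.+1)) :
  bounded_domain Db -> smooth_boundary Db -> 0 < Rr ->
  inner_ball_condition Db Rr ->
  (exists z, cBall z Rr `<=` interior (cyl Db)) ->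
  0 < m -> 0 < M -> 0 < g -> M * g * Rr < E ->
  Dbprime Db Rr xt ->
  let D := cyl Db in
  let IB y l := intRd (Ball (xt, y) Rr) (fun p => l * expR (- l * p.2)) in
  let IO y l := intRd (D `\` Ball (xt, y) Rr) (fun p => l * expR (- l * p.2)) in
  let JO y l :=
    intRd (D `\` Ball (xt, y) Rr) (fun p => p.2 * (l * expR (- l * p.2))) in
  let eq1 y l := M = m * (IB y l / IO y l) in
  let eq2 y l :=
    (n.+2)%:R * m * g / (2 * l) + m * g * (JO y l / IO y l) + M * g * y = E in
  (exists! l, 0 < l /\ eq2 Rr l) /\
  (forall ls, 0 < ls -> eq2 Rr ls ->
    M < m * (IB Rr ls / IO Rr ls) ->
    exists yA lA,
      [/\ (Rr <= yA /\ 0 < lA /\ eq1 yA lA /\ eq2 yA lA),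
          (forall y l, Rr <= y -> 0 < l -> eq1 y l -> eq2 y l ->
             y = yA /\ l = lA),
          Rr < yA & yA < E / (M * g)]).
Proof.
move=> [_ oDb _ bDb] _ r0 _ _ m0 M0 g0 rE xD D IB IO JO eq1 eq2.
have [V V0 ballV] := @leb_ball R n.
pose A := base_area Db; pose b := cap_mass n Rr V; pose b1 := cap_moment n Rr V.
(* Where [Rr <= y] and [0 < l], these closed forms turn [eq1] and [eq2] into the equations solved
   above, with [k = n.+2]. *)
have IBE y l : 0 < l -> IB y l = l * expR (- (l * (y - Rr))) * b l.
  by move=> l0; exact: intRd_ball.
have IOE y l : Rr <= y -> 0 < l -> IO y l = A - l * expR (- (l * (y - Rr))) * b l.
  by move=> ry l0; exact: intRd_outside.
have JOE y l : Rr <= y -> 0 < l ->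
    JO y l = A / l - l * expR (- (l * (y - Rr))) * (b1 l + (y - Rr) * b l).
  by move=> ry l0; exact: intRd_height_outside.
have A0 : 0 < A by exact: (base_area_gt0 r0 V0 oDb bDb xD ballV).
have k0 : 0 < n.+2%:R :> R by rewrite ltr0n.
have b_gt0 l : 0 < l -> 0 < b l by move=> _; exact: cap_mass_gt0.
have b1_ge0 l : 0 < l -> 0 <= b1 l by move=> _; rewrite ltW// cap_moment_gt0.
have b1_le l : 0 < l -> b1 l <= 2 * Rr * b l by move=> _; rewrite ltW// cap_moment_lt.
have db (l : R) : 0 < l -> is_derive l 1 b (- b1 l) by move=> _; exact: is_derive_cap_mass.
have cb1 (l : R) : 0 < l -> {for l, continuous b1} by move=> _; exact: continuous_cap_moment.
have b_lt l : 0 < l -> l * b l < A by exact: (cap_mass_lt_area r0 V0 oDb bDb xD ballV).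
have b_decay : exists2 L, 0 < L & forall l, L <= l -> l * b l <= A / 2.
  by apply: cap_mass_decay => //; rewrite divr_gt0.
have tau (l1 l2 : R) : 0 < l1 -> l1 <= l2 -> l1 * b1 l1 * b l2 <= l2 * b1 l2 * b l1.
  exact: cap_mean_mono.
have anti (l1 l2 : R) : 0 < l1 -> l1 <= l2 ->
    (A / l2 - l2 * b1 l2) * (A - l1 * b l1) <= (A / l1 - l1 * b1 l1) * (A - l2 * b l2).
  exact: (mean_height_anti r0 V0 oDb bDb xD ballV).
have JO_ge0 y l : Rr <= y -> 0 < l ->
    0 <= A / l - l * expR (- (l * (y - Rr))) * (b1 l + (y - Rr) * b l).
  by move=> ry l0; rewrite -JOE//; exact: intRd_height_outside_ge0.
have bot := equilibrium_bottom r0 m0 M0 g0 rE k0 b1_ge0 db cb1 b_lt b_decay anti JO_ge0.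
have top := equilibrium r0 m0 M0 g0 rE k0 A0 b_gt0 b1_ge0 b1_le db cb1 b_lt tau anti JO_ge0.
split.
  have [l [[l0 el] lU]] := bot; exists l; split.
    by split => //; rewrite /eq2 IOE// JOE.
  by move=> l' [l'0]; rewrite /eq2 IOE// JOE// => el'; exact: lU.
move=> ls ls0; rewrite /eq2 IOE// JOE// IBE// => els Mls.
have [yA [lA [[ryA [lA0 [e1 e2]]] U ryA' yAE]]] := top _ ls0 els Mls.
exists yA, lA; split => //.
  by rewrite /eq1 IBE// IOE// JOE.
by move=> y l ry l0; rewrite /eq1 IBE// IOE// JOE//; exact: U.
Qed.
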